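(* Let $K$ be a domain enclosed by a $\mathcal{C}_+^2$ closed and strictly convex plane curve $\gamma$, with area $A(K)$ and perimeter $L(K)$, let $\rho(\theta)$ be the radius of curvature of $\gamma$, let $\tilde A(K)$ denote the oriented area of the domain enclosed by the locus of curvature centers of $\gamma$, and let $S(K)$ denote the Steiner disc associated with $K$. Then for arbitrary real constants $\alpha,\beta,\lambda,\delta$ which satisfy $$2\alpha+\delta\ge 0,\qquad 2\alpha+4\pi\beta+\lambda\ge 0,\qquad 18\alpha-3\lambda+12\delta-2\ge 0,$$ we have $$h_2(K,S(K))^2\le\alpha\int_0^{2\pi}\rho(\theta)^2\,d\theta+\beta L(K)^2+\lambda A(K)+\delta|\tilde A(K)|.$$ Equality holds in this inequality if $\gamma$ is a circle and the parameters satisfy $2\alpha+4\pi\beta+\lambda=0$. Moreover, if equality holds in this inequality and the parameters satisfy $$2\alpha+\delta>0,\qquad 2\alpha+4\pi\beta+\lambda=0,\qquad 18\alpha-3\lambda+12\delta-2=0,$$ then the Minkowski support function of $\gamma$ is of the form $$p(\theta)=a_0+a_1\cos\theta+b_1\sin\theta+a_2\cos 2\theta+b_2\sin 2\theta$$ for some real constants $a_0,a_1,b_1,a_2,b_2$.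
   Context: A $\mathcal{C}_+^2$ closed and strictly convex plane curve is a closed convex curve of class $C^2$ with everywhere positive curvature. It is parametrized by the angle $\theta\in[0,2\pi]$ between the $x$-axis and the outward unit normal vector at the corresponding point. The Minkowski support function $p=p_K$ of $K$ (equivalently, of $\gamma$) is the $2\pi$-periodic function such that $$\gamma(\theta)=\big(p(\theta)\cos\theta-p'(\theta)\sin\theta,\ p(\theta)\sin\theta+p'(\theta)\cos\theta\big).$$ The radius of curvature is $\rho(\theta)=p(\theta)+p''(\theta)>0$. The perimeter is $L(K)=\int_0^{2\pi}p(\theta)\,d\theta$ and the area is $A(K)=\frac12\int_0^{2\pi}\big(p(\theta)^2-p'(\theta)^2\big)\,d\theta$. The locus of curvature centers is the curve $$\theta\mapsto\big(-p'(\theta)\sin\theta-p''(\theta)\cos\theta,\ p'(\theta)\cos\theta-p''(\theta)\sin\theta\big),$$ and the oriented area of the domain it encloses is $\tilde A(K)=\frac12\int_0^{2\pi}\big(p'(\theta)^2-p''(\theta)^2\big)\,d\theta$. For planar convex bodies $K,M$ with support functions $p_K,p_M$, the $L^2$-distance is $$h_2(K,M)=\left(\int_0^{2\pi}|p_K(\theta)-p_M(\theta)|^2\,d\theta\right)^{1/2}.$$ The Steiner disc $S(K)$ of a planar convex body $K$ is the circular disc with radius $\frac{L(K)}{2\pi}$ and center at the Steiner point $$\overrightarrow{s}(K)=\frac1\pi\int_0^{2\pi}\overrightarrow{u}(\theta)\,p_K(\theta)\,d\theta,$$ where $\overrightarrow{u}(\theta)=(\cos\theta,\sin\theta)$ is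 the outward unit normal vector with angle $\theta$. *)

(* Defs.v *)
From Stdlib Require Import Reals ZArith.
From Coquelicot Require Import Coquelicot.
Open Scope R_scope.

(** * Plane geometry

    The plane is [R * R]; Coquelicot's [norm] on it is the Euclidean norm. *)

Definition dot (z w : R * R) : R := fst z * fst w + snd z * snd w.

Definition unit_vec (theta : R) : R * R := (cos theta, sin theta).

Definition boundary (K : R * R -> Prop) (z : R * R) : Prop :=
  ~ locally z K /\ ~ locally z (fun w => ~ K w).

Definition bounded (K : R * R -> Prop) : Prop :=
  exists M : R, forall z, K z -> norm z <= M.

(** Proper convex combinations of distinct points of [K] are interior to [K]. *)
Definition strictly_convex (K : R * R -> Prop) : Prop :=
  forall z w s, K z -> K w -> z <> w -> 0 < s < 1 ->
    locally (plus (scal s z) (scal (1 - s) w)) K.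

Definition closed_disc (a : R * R) (r : R) (z : R * R) : Prop :=
  norm (minus z a) <= r.

(** * Curves *)

Definition class_C2 (f : R -> R) : Prop :=
  (forall t, ex_derive f t) /\
  (forall t, ex_derive (Derive f) t) /\
  (forall t, continuous (Derive (Derive f)) t).

Definition xcoord (c : R -> R * R) (t : R) : R := fst (c t).
Definition ycoord (c : R -> R * R) (t : R) : R := snd (c t).

Definition velocity (c : R -> R * R) (t : R) : R * R :=
  (Derive (xcoord c) t, Derive (ycoord c) t).

Definition acceleration (c : R -> R * R) (t : R) : R * R :=
  (Derive (Derive (xcoord c)) t, Derive (Derive (ycoord c)) t).

(** Signed curvature, [(x' y'' - y' x'') / |c'|^3]: it is positive where a
    curve turns left. *)
Definition curvature (c : R -> R * R) (t : R) : R :=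
  (fst (velocity c t) * snd (acceleration c t)
   - snd (velocity c t) * fst (acceleration c t)) / norm (velocity c t) ^ 3.

(** The unit tangent turned clockwise by a right angle.  The convex curves
    below have positive signed curvature, hence run counterclockwise, so that
    this vector points out of the domain they enclose. *)
Definition outward_normal (c : R -> R * R) (t : R) : R * R :=
  scal (/ norm (velocity c t)) (snd (velocity c t), - fst (velocity c t)).

(** [c] is a regular, simple, [T]-periodic parametrization of a closed and
    strictly convex plane curve of class C^2_+, and [K] is the (closed) domain
    enclosed by this curve.  The parameter of [c] is arbitrary: the
    parametrization by the normal angle is in general only of class C^1. *)
Record C2plus_domain (K : R * R -> Prop) (c : R -> R * R) (T : R) : Prop := {
  C2plus_closed : closed K;
  C2plus_bounded : bounded K;
  C2plus_strictly_convex : strictly_convex K;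
  C2plus_boundary : forall z, boundary K z <-> exists t, c t = z;
  C2plus_period_pos : 0 < T;
  C2plus_periodic : forall t, c (t + T) = c t;
  C2plus_simple : forall s t, c s = c t -> exists k : Z, s = t + IZR k * T;
  C2plus_x_C2 : class_C2 (xcoord c);
  C2plus_y_C2 : class_C2 (ycoord c);
  C2plus_regular : forall t, velocity c t <> (0, 0);
  C2plus_curvature_pos : forall t, 0 < curvature c t
}.

(** [rho theta] is the radius of curvature at the point of the curve where the
    outward unit normal has angle [theta]. *)
Definition is_radius_of_curvature (c : R -> R * R) (rho : R -> R) : Prop :=
  forall theta t, outward_normal c t = unit_vec theta ->
    rho theta = / curvature c t.

Definition is_circle (c : R -> R * R) : Prop :=
  exists (a : R * R) (r : R), 0 < r /\
    forall z, (exists t, c t = z) <-> norm (minus z a) = r.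

(** * Functionals of planar convex bodies *)

(** Minkowski support function, [sup {<z, u(theta)> | z in K}]. *)
Definition support (K : R * R -> Prop) (theta : R) : R :=
  real (Lub_Rbar (fun s => exists z, K z /\ s = dot z (unit_vec theta))).

Definition perimeter (K : R * R -> Prop) : R :=
  RInt (support K) 0 (2 * PI).

Definition area (K : R * R -> Prop) : R :=
  / 2 * RInt (fun theta => support K theta ^ 2 - Derive (support K) theta ^ 2)
          0 (2 * PI).

(** Oriented area of the domain enclosed by the locus of curvature centers
    [(-p' sin - p'' cos, p' cos - p'' sin)], where [p] is the support
    function.  This locus need not be differentiable when the curve is only of
    class C^2, but the integral below still makes sense. *)
Definition evolute_area (K : R * R -> Prop) : R :=
  / 2 * RInt (fun theta => Derive (support K) theta ^ 2
                           - Derive (Derive (support K)) theta ^ 2)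
          0 (2 * PI).

Definition h2 (K M : R * R -> Prop) : R :=
  sqrt (RInt (fun theta => Rabs (support K theta - support M theta) ^ 2)
          0 (2 * PI)).

Definition steiner_point (K : R * R -> Prop) : R * R :=
  (/ PI * RInt (fun theta => cos theta * support K theta) 0 (2 * PI),
   / PI * RInt (fun theta => sin theta * support K theta) 0 (2 * PI)).

Definition steiner_disc (K : R * R -> Prop) : R * R -> Prop :=
  closed_disc (steiner_point K) (perimeter K / (2 * PI)).

(* Main.v *)
Require Import Defs.
From Stdlib Require Import Reals ZArith.
From Stdlib Require Import Lra Psatz.
From Stdlib Require Ranalysis5 Classical_Prop ClassicalEpsilon.
From Coquelicot Require Import Coquelicot.
Open Scope R_scope.

(** Each point of the curve maximizes over [K] the linear functional given by
    its outward normal, since the curve bends away from the normal.  The normal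
    angle has positive derivative, so the curve can be reparametrized by it;
    hence the support function [p] is of class C^2 and [p + p''] is the radius
    of curvature.

    Let [a] be the mean of [p], let [q] be [p] minus the support function of the
    Steiner disc, and put [w = q + q''], [X = int w^2], [Y = - int q w],
    [Z = int q^2].  All functionals are combinations of [a^2], [X], [Y], [Z],
    and the two sides of the inequality differ by a combination, with
    nonnegative coefficients, of [a^2], [Y], [Y - 3 Z] and
    [X - 6 Y + 9 Z = int (w + 3 q)^2].

    The inequality [3 Z <= Y], i.e. [int q'^2 >= 4 int q^2] for [q] orthogonal
    to [1], [cos], [sin], is obtained without Fourier series.  The function
    [q(t) - q(t + pi/2) + q(t + pi) - q(t + 3 pi/2)] changes sign under
    [t -> t + pi/2], so it has a zero [t].  Some [A + b cos + c sin] then agrees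
    with [q] at the four points [t + k pi/2]; subtracting it only decreases
    [int q'^2 - 4 int q^2], and the difference satisfies the Dirichlet
    inequality on each of the four intervals of length [pi/2].

    In the equality case [w + 3 q = 0], i.e. [q'' = - 4 q]. *)

(** * Continuity and integration of real functions *)

Definition cont (f : R -> R) : Prop := forall x, continuous f x.

Lemma continuous_Rplus (f g : R -> R) (x : R) :
  continuous f x -> continuous g x -> continuous (fun y => f y + g y) x.
Proof. apply (continuous_plus f g x). Qed.

Lemma continuous_Ropp (f : R -> R) (x : R) :
  continuous f x -> continuous (fun y => - f y) x.
Proof. apply (continuous_opp f x). Qed.

Lemma continuous_Rminus (f g : R -> R) (x : R) :
  continuous f x -> continuous g x -> continuous (fun y => f y - g y) x.
Proof. apply (continuous_minus f g x). Qed.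

Lemma continuous_Rmult (f g : R -> R) (x : R) :
  continuous f x -> continuous g x -> continuous (fun y => f y * g y) x.
Proof. apply (continuous_mult f g x). Qed.

Lemma continuous_Rpow (f : R -> R) (n : nat) (x : R) :
  continuous f x -> continuous (fun y => f y ^ n) x.
Proof.
  intros hf. induction n as [|n IH]; simpl.
  - apply continuous_const.
  - now apply continuous_Rmult.
Qed.

Lemma continuous_of_derive (f : R -> R) (x l : R) :
  is_derive f x l -> continuous f x.
Proof. intros hf. apply (ex_derive_continuous f). now exists l. Qed.

Lemma cont_derive (f f' : R -> R) : (forall x, is_derive f x (f' x)) -> cont f.
Proof. intros hf x. exact (continuous_of_derive f x (f' x) (hf x)). Qed.

Lemma cont_cos : cont cos.
Proof. intros x. exact (continuous_of_derive _ _ _ (is_derive_cos x)). Qed.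

Lemma cont_sin : cont sin.
Proof. intros x. exact (continuous_of_derive _ _ _ (is_derive_sin x)). Qed.

Ltac continuous_atom :=
  first [ assumption
        | match goal with H : cont ?f |- continuous ?f ?x => exact (H x) end
        | match goal with |- continuous cos ?x => exact (cont_cos x) end
        | match goal with |- continuous sin ?x => exact (cont_sin x) end ].

Ltac prove_cont :=
  lazymatch goal with
  | |- cont _ => let y := fresh in intros y; prove_cont
  | |- continuous (fun _ => ?c) _ => apply continuous_const
  | |- continuous (fun y => y) _ => apply continuous_id
  | |- continuous (fun y => _ + _) _ => apply continuous_Rplus; prove_cont
  | |- continuous (fun y => _ - _) _ => apply continuous_Rminus; prove_cont
  | |- continuous (fun y => - _) _ => apply continuous_Ropp; prove_cont
  | |- continuous (fun y => _ * _) _ => apply continuous_Rmult; prove_cont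
  | |- continuous (fun y => _ ^ _) _ => apply continuous_Rpow; prove_cont
  | |- continuous (fun y => ?f y) ?x => change (continuous f x); continuous_atom
  | |- _ => continuous_atom
  end.

(* [ring] and [field] fail on terms typed by a Coquelicot structure on [R]
   instead of by [R] itself, as [RInt] is. *)
Ltac eq_R :=
  repeat match goal with |- context [RInt ?f ?a ?b] =>
    let r := fresh in
    generalize (RInt f a b); intros r; change R in r end;
  match goal with |- ?a = ?b => change (@eq R a b) end.

Lemma ex_RInt_cont (f : R -> R) (a b : R) : cont f -> ex_RInt f a b.
Proof. intros hf. apply (ex_RInt_continuous f). intros x _. apply hf. Qed.

Lemma RInt_eq (f g : R -> R) (a b : R) :
  (forall x, f x = g x) -> RInt f a b = RInt g a b.
Proof. intros h. apply RInt_ext. intros x _. apply h. Qed.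

Lemma RInt_add (f g : R -> R) (a b : R) : cont f -> cont g ->
  RInt (fun x => f x + g x) a b = RInt f a b + RInt g a b.
Proof. intros hf hg. apply (RInt_plus f g); now apply ex_RInt_cont. Qed.

Lemma RInt_sub (f g : R -> R) (a b : R) : cont f -> cont g ->
  RInt (fun x => f x - g x) a b = RInt f a b - RInt g a b.
Proof. intros hf hg. apply (RInt_minus f g); now apply ex_RInt_cont. Qed.

Lemma RInt_mulc (c : R) (f : R -> R) (a b : R) : cont f ->
  RInt (fun x => c * f x) a b = c * RInt f a b.
Proof. intros hf. apply (RInt_scal f a b c). now apply ex_RInt_cont. Qed.

Lemma RInt_derivative (f f' : R -> R) (a b : R) :
  (forall x, is_derive f x (f' x)) -> cont f' -> RInt f' a b = f b - f a.
Proof.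
  intros hf hc. apply is_RInt_unique.
  apply (is_RInt_derive f f'); intros x _; auto.
Qed.

Lemma RInt_nonneg (f : R -> R) (a b : R) : a <= b -> cont f ->
  (forall x, 0 <= f x) -> 0 <= RInt f a b.
Proof. intros hab hf hp. apply RInt_ge_0; auto. now apply ex_RInt_cont. Qed.

(** If [f x] were nonzero, continuity would keep [f ^ 2] above half of [f x ^ 2] on a small interval
    around [x], and this interval alone would make the integral positive. *)
Lemma RInt_square_eq_0 (f : R -> R) (a b : R) : a < b -> cont f ->
  RInt (fun x => f x ^ 2) a b = 0 -> forall x, a < x < b -> f x = 0.
Proof.
  intros hab hf h0 x hx.
  destruct (Req_dec (f x) 0) as [e|ne]; [exact e|exfalso].
  assert (hpos : 0 < f x ^ 2) by nra.
  assert (hc : cont (fun x => f x ^ 2)) by prove_cont.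
  assert (hl : locally x (fun y => f x ^ 2 / 2 < f y ^ 2)).
  { apply (hc x (fun v => f x ^ 2 / 2 < v)).
    apply (open_gt (f x ^ 2 / 2)). simpl in *; lra. }
  destruct hl as [e he].
  pose proof (cond_pos e) as ep.
  set (d := Rmin (e / 2) (Rmin ((x - a) / 2) ((b - x) / 2))).
  assert (hd : 0 < d /\ d < e /\ d < x - a /\ d < b - x).
  { unfold d, Rmin. repeat destruct Rle_dec; lra. }
  destruct hd as (d0 & d1 & d2 & d3).
  assert (hsplit : RInt (fun x => f x ^ 2) a b
    = RInt (fun x => f x ^ 2) a (x - d) + RInt (fun x => f x ^ 2) (x - d) (x + d)
      + RInt (fun x => f x ^ 2) (x + d) b).
  { rewrite <- (RInt_Chasles (fun x => f x ^ 2) a (x + d) b)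
      by now apply ex_RInt_cont.
    rewrite <- (RInt_Chasles (fun x => f x ^ 2) a (x - d) (x + d))
      by now apply ex_RInt_cont.
    reflexivity. }
  assert (h1 : 0 <= RInt (fun x => f x ^ 2) a (x - d))
    by (apply RInt_nonneg; [lra|exact hc|intros; nra]).
  assert (h3 : 0 <= RInt (fun x => f x ^ 2) (x + d) b)
    by (apply RInt_nonneg; [lra|exact hc|intros; nra]).
  assert (h2 : 0 < RInt (fun x => f x ^ 2) (x - d) (x + d)).
  { apply RInt_gt_0; [lra| |intros y _; apply hc].
    intros y hy. assert (f x ^ 2 / 2 < f y ^ 2); [|lra].
    apply he. unfold ball; simpl; unfold AbsRing_ball, abs, minus, plus, opp; simpl.
    apply Rabs_def1; lra. }
  lra.
Qed.

(** Translation by [P] carries the integral over [[0, a]] to the one over [[P, a + P]]; then compare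
    the two ways of splitting [[0, a + P]], at [P] and at [a]. *)
Lemma RInt_period (f : R -> R) (P a : R) : cont f -> (forall x, f (x + P) = f x) ->
  RInt f a (a + P) = RInt f 0 P.
Proof.
  intros hf hp.
  assert (e : RInt f P (a + P) = RInt f 0 a).
  { symmetry. transitivity (RInt (fun x => scal 1 (f (1 * x + P))) 0 a).
    - apply RInt_ext. intros x _. unfold scal; simpl; unfold mult; simpl.
      now rewrite 2!Rmult_1_l, hp.
    - rewrite (RInt_comp_lin f 1 P) by now apply ex_RInt_cont.
      f_equal; ring. }
  pose proof (RInt_Chasles f 0 P (a + P)) as c1.
  pose proof (RInt_Chasles f 0 a (a + P)) as c2.
  specialize (c1 (ex_RInt_cont _ _ _ hf) (ex_RInt_cont _ _ _ hf)).
  specialize (c2 (ex_RInt_cont _ _ _ hf) (ex_RInt_cont _ _ _ hf)).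
  unfold plus in *; simpl in *. lra.
Qed.

(** * The Wirtinger inequality for functions orthogonal to [1], [cos] and [sin] *)

(** Completing the square with the tangent, which solves a Riccati equation:
    [f' ^ 2 - k ^ 2 * f ^ 2] is a square plus the derivative of [g], and [g] vanishes at both
    endpoints together with [f]. *)
Lemma wirtinger_dirichlet_lt (k a : R) (f f' : R -> R) :
  0 < k < 2 -> (forall x, is_derive f x (f' x)) -> cont f' ->
  f a = 0 -> f (a + PI / 2) = 0 ->
  k ^ 2 * RInt (fun x => f x ^ 2) a (a + PI / 2)
    <= RInt (fun x => f' x ^ 2) a (a + PI / 2).
Proof.
  intros hk hd hc ha hb.
  pose proof PI_RGT_0 as pp.
  (* The midpoint: [k * |x - m| <= k * pi / 4 < pi / 2], so the tangent has no pole on the closed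
     interval. *)
  set (m := a + PI / 4).
  set (g := fun x => - k * (f x ^ 2 * tan (k * (x - m)))).
  set (g' := fun x => - k * (2 * f x * f' x * tan (k * (x - m))
     + f x ^ 2 * (k * (tan (k * (x - m)) ^ 2 + 1)))).
  assert (hcf : cont f) by exact (cont_derive _ _ hd).
  assert (hcos : forall x, a <= x <= a + PI / 2 -> cos (k * (x - m)) <> 0).
  { intros x hx. apply Rgt_not_eq, cos_gt_0; unfold m; nra. }
  assert (hg : forall x, a <= x <= a + PI / 2 -> is_derive g x (g' x)).
  { intros x hx. unfold g, g'. auto_derive.
    - split; [|split]; [exists (f' x); apply hd| |exact I].
      exists (tan (k * (x - m)) ^ 2 + 1). apply is_derive_tan, (hcos x hx).
    - change (fun x0 => f x0) with f. change (fun x0 => tan x0) with tan.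
      rewrite (is_derive_unique _ _ _ (hd x)).
      assert (ht : Derive tan (k * (x + - m)) = tan (k * (x - m)) ^ 2 + 1)
        by exact (is_derive_unique tan _ _ (is_derive_tan _ (hcos x hx))).
      rewrite ht.
      unfold Rminus. ring. }
  assert (hg'c : forall x, a <= x <= a + PI / 2 -> continuous g' x).
  { intros x hx.
    assert (ht : continuous (fun x => tan (k * (x - m))) x).
    { apply (ex_derive_continuous (fun x => tan (k * (x - m)))).
      exists (k * (tan (k * (x - m)) ^ 2 + 1)).
      apply (is_derive_comp tan (fun x => k * (x - m)) x).
      - apply is_derive_tan, (hcos x hx).
      - auto_derive; [exact I|ring]. }
    unfold g'. set (t := fun x => tan (k * (x - m))) in *.
    change (continuous (fun x => - k * (2 * f x * f' x * t x
       + f x ^ 2 * (k * (t x ^ 2 + 1)))) x).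
    prove_cont. }
  assert (hmm : Rmin a (a + PI / 2) = a /\ Rmax a (a + PI / 2) = a + PI / 2).
  { split; [apply Rmin_left|apply Rmax_right]; lra. }
  destruct hmm as [hmin hmax].
  assert (hgi : is_RInt g' a (a + PI / 2) 0).
  { replace 0 with (minus (g (a + PI / 2)) (g a)).
    - apply (is_RInt_derive g g'); rewrite hmin, hmax; assumption.
    - unfold minus, plus, opp, g; simpl. rewrite ha, hb. ring. }
  assert (hle : 0 <= RInt (fun x => f' x ^ 2 - k ^ 2 * f x ^ 2) a (a + PI / 2)).
  { rewrite <- (is_RInt_unique _ _ _ _ hgi).
    apply RInt_le; [lra|now exists 0|apply ex_RInt_cont; prove_cont|].
    intros x hx. unfold g'.
    (* This square is exactly [f' x ^ 2 - k ^ 2 * f x ^ 2 - g' x]. *)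
    pose proof (pow2_ge_0 (f' x + k * f x * tan (k * (x - m)))) as sq.
    apply Rminus_le_0. eapply Rle_trans; [exact sq|].
    apply Req_le. ring. }
  rewrite RInt_sub, RInt_mulc in hle by prove_cont. lra.
Qed.

(* The strict case [k < 2] is sharp in the limit, and avoids the poles that
   [tan (2 (x - a - pi/4))] has at the endpoints. *)
Lemma wirtinger_dirichlet (a : R) (f f' : R -> R) :
  (forall x, is_derive f x (f' x)) -> cont f' ->
  f a = 0 -> f (a + PI / 2) = 0 ->
  0 <= RInt (fun x => f' x ^ 2 - 4 * f x ^ 2) a (a + PI / 2).
Proof.
  intros hd hc ha hb.
  pose proof PI_RGT_0 as pp.
  assert (hcf : cont f) by exact (cont_derive _ _ hd).
  rewrite RInt_sub, RInt_mulc by prove_cont.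
  assert (hk : forall k, 0 < k < 2 ->
    k ^ 2 * RInt (fun x => f x ^ 2) a (a + PI / 2)
      <= RInt (fun x => f' x ^ 2) a (a + PI / 2))
    by (intros k hk; now apply wirtinger_dirichlet_lt).
  assert (hW : 0 <= RInt (fun x => f' x ^ 2) a (a + PI / 2))
    by (apply RInt_nonneg; [lra|prove_cont|intros; apply pow2_ge_0]).
  revert hk hW. generalize (RInt (fun x => f x ^ 2) a (a + PI / 2)) as Z.
  generalize (RInt (fun x => f' x ^ 2) a (a + PI / 2)) as W. intros W Z hk hW.
  destruct (Rle_or_lt (4 * Z) W) as [h|h]; [lra|exfalso].
  assert (hZ : 0 < Z) by lra.
  (* For this [e], [(2 - e) ^ 2 * Z = (4 * Z + W) / 2 + e ^ 2 * Z > W], against the bound for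
     [k = 2 - e]. *)
  set (e := (4 * Z - W) / (8 * Z)).
  assert (he : e * (8 * Z) = 4 * Z - W) by (unfold e; field; lra).
  assert (he0 : 0 < e) by (apply Rdiv_lt_0_compat; lra).
  assert (he1 : e <= 1 / 2) by nra.
  specialize (hk (2 - e)). nra.
Qed.

Lemma is_derive_periodic (f f' : R -> R) (P : R) :
  (forall x, is_derive f x (f' x)) -> (forall x, f (x + P) = f x) ->
  forall x, f' (x + P) = f' x.
Proof.
  intros hd hp x.
  rewrite <- (is_derive_unique _ _ _ (hd x)).
  rewrite <- (Derive_ext (fun y => f (y + P)) f x hp).
  symmetry. apply is_derive_unique.
  replace (f' (x + P)) with (scal 1 (f' (x + P))) by apply Rmult_1_l.
  apply (is_derive_comp f (fun y => y + P)); [apply hd|auto_derive; trivial].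
Qed.

(** The alternating sum annihilates [1], [cos] and [sin]. Its vanishing is the condition under which
    their three-dimensional span can interpolate [q] at four equally spaced points. *)
Lemma alternating_sum_zero (q : R -> R) :
  cont q -> (forall x, q (x + 2 * PI) = q x) ->
  exists t, q t - q (t + PI / 2) + q (t + PI) - q (t + PI + PI / 2) = 0.
Proof.
  intros hc hp. pose proof PI_RGT_0 as pp.
  set (D := fun t => q t - q (t + PI / 2) + q (t + PI) - q (t + PI + PI / 2)).
  assert (hs : forall a x, continuous (fun y => q (y + a)) x).
  { intros a x. apply (continuous_comp (fun y => y + a) q); [|apply hc].
    apply continuous_Rplus; [apply continuous_id|apply continuous_const]. }
  assert (hD : continuity D).
  { intros x. apply continuity_pt_filterlim. change (continuous D x). unfold D.
    apply continuous_Rminus; [apply continuous_Rplus; [apply continuous_Rminus|]|].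
    - apply hc.
    - apply hs.
    - apply hs.
    - apply (continuous_ext (fun y => q (y + (PI + PI / 2)))); [|apply hs].
      intros y. f_equal. ring. }
  assert (hD0 : D (0 + PI / 2) = - D 0).
  { unfold D. rewrite <- (hp 0).
    replace (0 + PI / 2 + PI / 2) with (0 + PI) by field.
    replace (0 + PI / 2 + PI) with (0 + PI + PI / 2) by field.
    replace (0 + PI + PI / 2 + PI / 2) with (0 + 2 * PI) by field. ring. }
  destruct (IVT_cor D 0 (0 + PI / 2) hD) as [t [_ ht]].
  - lra.
  - rewrite hD0. nra.
  - now exists t.
Qed.

(** Put [h = b cos + c sin]. Since [h'' = - h], integrating [- 2 q' h'] by parts gives [- 2 q h], so
    all cross terms are multiples of [q] and [q h] and integrate to zero. What remains is the
    integral of [h' ^ 2 - 4 (A + h) ^ 2]. *)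
Lemma wirtinger_trig_interpolation (q q' : R -> R) (A b c : R) :
  (forall x, is_derive q x (q' x)) -> cont q' ->
  (forall x, q (x + 2 * PI) = q x) ->
  RInt q 0 (2 * PI) = 0 ->
  RInt (fun x => cos x * q x) 0 (2 * PI) = 0 ->
  RInt (fun x => sin x * q x) 0 (2 * PI) = 0 ->
  RInt (fun x => (q' x - (- b * sin x + c * cos x)) ^ 2
                 - 4 * (q x - (A + b * cos x + c * sin x)) ^ 2) 0 (2 * PI)
  = RInt (fun x => q' x ^ 2 - 4 * q x ^ 2) 0 (2 * PI)
    - (8 * PI * A ^ 2 + 3 * PI * (b ^ 2 + c ^ 2)).
Proof.
  intros hd hc hp h0 hcos hsin.
  assert (hcq : cont q) by exact (cont_derive _ _ hd).
  (* A primitive of [- 2 (q h')' + h' ^ 2 - 4 (A + h) ^ 2]; only its terms linear in [x] contribute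
     over a period. *)
  set (G := fun x => - 2 * (q x * (- b * sin x + c * cos x))
     + (b ^ 2 - 4 * c ^ 2) * (x / 2 - sin x * cos x / 2)
     + (c ^ 2 - 4 * b ^ 2) * (x / 2 + sin x * cos x / 2)
     - 5 * b * c * sin x ^ 2 - 4 * A ^ 2 * x
     - 8 * A * b * sin x + 8 * A * c * cos x).
  set (G' := fun x => - 2 * (q' x * (- b * sin x + c * cos x)
       + q x * (- b * cos x - c * sin x))
     + (b ^ 2 - 4 * c ^ 2) * sin x ^ 2 + (c ^ 2 - 4 * b ^ 2) * cos x ^ 2
     - 10 * b * c * (sin x * cos x) - 4 * A ^ 2
     - 8 * A * b * cos x - 8 * A * c * sin x).
  assert (hG : forall x, is_derive G x (G' x)).
  { intros x. unfold G, G'. auto_derive.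
    - exists (q' x). apply hd.
    - change (fun x0 => q x0) with q. rewrite (is_derive_unique _ _ _ (hd x)).
      pose proof (sin2_cos2 x) as e. unfold Rsqr in e.
      apply Rminus_diag_uniq.
      transitivity ((1 - (sin x * sin x + cos x * cos x))
        * (b ^ 2 - 4 * c ^ 2 + c ^ 2 - 4 * b ^ 2) / 2).
      + field.
      + rewrite e. field. }
  assert (hG'c : cont G') by (unfold G'; prove_cont).
  transitivity (RInt (fun x => (q' x ^ 2 - 4 * q x ^ 2)
    + (8 * A * q x + (6 * b * (cos x * q x) + (6 * c * (sin x * q x) + G' x))))
    0 (2 * PI)).
  - apply RInt_eq. intros x. unfold G'. ring.
  - rewrite 4!RInt_add, 3!RInt_mulc by prove_cont.
    rewrite h0, hcos, hsin, (RInt_derivative G G' _ _ hG hG'c).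
    unfold G. rewrite <- (hp 0), Rplus_0_l, sin_2PI, cos_2PI, sin_0, cos_0.
    eq_R. field.
Qed.

(** The constant [4] is the square of the lowest frequency left once [1], [cos] and [sin] are
    removed; [cos (2 x)] attains equality. *)
Lemma wirtinger_order2 (q q' : R -> R) :
  (forall x, is_derive q x (q' x)) -> cont q' ->
  (forall x, q (x + 2 * PI) = q x) ->
  RInt q 0 (2 * PI) = 0 ->
  RInt (fun x => cos x * q x) 0 (2 * PI) = 0 ->
  RInt (fun x => sin x * q x) 0 (2 * PI) = 0 ->
  0 <= RInt (fun x => q' x ^ 2 - 4 * q x ^ 2) 0 (2 * PI).
Proof.
  intros hd hc hp h0 hcos hsin. pose proof PI_RGT_0 as pp.
  assert (hcq : cont q) by exact (cont_derive _ _ hd).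
  destruct (alternating_sum_zero q hcq hp) as [t ht].
  (* [A + B cos (x - t) + C sin (x - t)] interpolates [q] at the four points
     [t + k pi / 2], on which [ht] is the only constraint. *)
  set (A := (q t + q (t + PI)) / 2).
  set (B := (q t - q (t + PI)) / 2).
  set (C := (q (t + PI / 2) - q (t + PI + PI / 2)) / 2).
  set (b := B * cos t - C * sin t). set (c := B * sin t + C * cos t).
  set (f := fun x => q x - (A + b * cos x + c * sin x)).
  set (f' := fun x => q' x - (- b * sin x + c * cos x)).
  assert (e1 := sin2_cos2 t). unfold Rsqr in e1.
  assert (hf : forall x, is_derive f x (f' x)).
  { intros x. unfold f, f'. auto_derive.
    - exists (q' x). apply hd.
    - change (fun x0 => q x0) with q. rewrite (is_derive_unique _ _ _ (hd x)). ring. }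
  assert (hf'c : cont f') by (unfold f'; prove_cont).
  assert (hfc : cont f) by exact (cont_derive _ _ hf).
  assert (f0 : f t = 0).
  { unfold f, b, c.
    transitivity (q t - (A + B * (sin t * sin t + cos t * cos t))); [ring|].
    rewrite e1. unfold A, B. field. }
  (* Here [A] must also be the mean of [q (t + PI / 2)] and [q (t + PI + PI / 2)], which is what
     [ht] says. *)
  assert (f1 : f (t + PI / 2) = 0).
  { unfold f, b, c. rewrite cos_plus, sin_plus, cos_PI2, sin_PI2.
    transitivity (q (t + PI / 2) - (A + C * (sin t * sin t + cos t * cos t))); [ring|].
    rewrite e1. unfold A, C. lra. }
  assert (f2 : f (t + PI) = 0).
  { unfold f, b, c. rewrite neg_cos, neg_sin.
    transitivity (q (t + PI) - (A - B * (sin t * sin t + cos t * cos t))); [ring|].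
    rewrite e1. unfold A, B. field. }
  assert (f3 : f (t + PI + PI / 2) = 0).
  { unfold f, b, c.
    rewrite (cos_plus (t + PI)), (sin_plus (t + PI)), cos_PI2, sin_PI2, neg_cos, neg_sin.
    transitivity (q (t + PI + PI / 2) - (A - C * (sin t * sin t + cos t * cos t)));
      [ring|].
    rewrite e1. unfold A, C. lra. }
  assert (hfp : forall x, f (x + 2 * PI) = f x).
  { intros x. unfold f. rewrite hp, cos_plus, sin_plus, cos_2PI, sin_2PI. ring. }
  assert (f4 : f (t + PI + PI / 2 + PI / 2) = 0).
  { replace (t + PI + PI / 2 + PI / 2) with (t + 2 * PI) by field. now rewrite hfp. }
  assert (hf'p := is_derive_periodic _ _ _ hf hfp).
  set (E := fun x => f' x ^ 2 - 4 * f x ^ 2).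
  assert (hE : cont E) by (unfold E; prove_cont).
  (* The zeros of [f] cut the period starting at [t], so the integral is first moved there. *)
  assert (hEp : RInt E t (t + 2 * PI) = RInt E 0 (2 * PI)).
  { apply RInt_period; [exact hE|]. intros x. unfold E. now rewrite hfp, hf'p. }
  assert (hE0 : 0 <= RInt E t (t + 2 * PI)).
  { assert (d0 := wirtinger_dirichlet t f f' hf hf'c f0 f1).
    assert (d1 := wirtinger_dirichlet (t + PI / 2) f f' hf hf'c f1).
    replace (t + PI / 2 + PI / 2) with (t + PI) in d1 by field. specialize (d1 f2).
    assert (d2 := wirtinger_dirichlet (t + PI) f f' hf hf'c f2 f3).
    assert (d3 := wirtinger_dirichlet (t + PI + PI / 2) f f' hf hf'c f3 f4).
    replace (t + PI + PI / 2 + PI / 2) with (t + 2 * PI) in d3 by field.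
    rewrite <- (RInt_Chasles E t (t + PI)), <- (RInt_Chasles E t (t + PI / 2) (t + PI)),
      <- (RInt_Chasles E (t + PI) (t + PI + PI / 2) (t + 2 * PI))
      by now apply ex_RInt_cont.
    unfold plus; simpl. fold E in d0, d1, d2, d3. lra. }
  rewrite hEp in hE0. unfold E, f, f' in hE0.
  rewrite (wirtinger_trig_interpolation q q' A b c hd hc hp h0 hcos hsin) in hE0.
  assert (0 <= 8 * PI * A ^ 2 + 3 * PI * (b ^ 2 + c ^ 2)); [|lra].
  pose proof (pow2_ge_0 A). pose proof (pow2_ge_0 b). pose proof (pow2_ge_0 c).
  apply Rplus_le_le_0_compat; apply Rmult_le_pos; lra.
Qed.

(** * Integrals of a support function *)

Lemma RInt_periodic_derivative (f f' : R -> R) (P : R) :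
  (forall x, is_derive f x (f' x)) -> cont f' -> f P = f 0 -> RInt f' 0 P = 0.
Proof. intros hf hc e. rewrite (RInt_derivative f f' 0 P hf hc), e. apply Rminus_diag. Qed.

Lemma zero_derivative (f : R -> R) :
  (forall x, is_derive f x 0) -> forall x, f x = f 0.
Proof.
  intros hf x. assert (e := RInt_derivative f (fun _ => 0) 0 x hf).
  rewrite RInt_const in e. unfold scal in e; simpl in e; unfold mult in e; simpl in e.
  assert (e' := e (fun y => continuous_const 0 y)). lra.
Qed.

(** The equation makes the vector [(q, q' / 2)] rotate clockwise by the angle [2 x]. Rotating it
    back yields the two constants of motion [e1] and [e2], from which [q] is recovered. *)
Lemma harmonic_oscillator (q q' q'' : R -> R) :
  (forall x, is_derive q x (q' x)) -> (forall x, is_derive q' x (q'' x)) ->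
  (forall x, q'' x = - 4 * q x) ->
  forall x, q x = q 0 * cos (2 * x) + q' 0 / 2 * sin (2 * x).
Proof.
  intros hd hd' ode x.
  assert (e1 := fun h => zero_derivative
    (fun y => q y * cos (2 * y) - q' y * sin (2 * y) / 2) h x).
  assert (e2 := fun h => zero_derivative
    (fun y => q y * sin (2 * y) + q' y * cos (2 * y) / 2) h x).
  cbv beta in e1, e2. rewrite Rmult_0_r, cos_0, sin_0 in e1, e2.
  assert (e3 := sin2_cos2 (2 * x)). unfold Rsqr in e3.
  transitivity (q x * (sin (2 * x) * sin (2 * x) + cos (2 * x) * cos (2 * x)));
    [rewrite e3; ring|].
  transitivity ((q x * cos (2 * x) - q' x * sin (2 * x) / 2) * cos (2 * x)
    + (q x * sin (2 * x) + q' x * cos (2 * x) / 2) * sin (2 * x)); [field|].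
  rewrite e1, e2; [field| |].
  - intros y. auto_derive.
    + repeat split; [exists (q' y); apply hd|exists (q'' y); apply hd'].
    + change (fun x0 => q x0) with q. change (fun x0 => q' x0) with q'.
      rewrite (is_derive_unique _ _ _ (hd y)), (is_derive_unique _ _ _ (hd' y)), ode.
      field.
  - intros y. auto_derive.
    + repeat split; [exists (q' y); apply hd|exists (q'' y); apply hd'].
    + change (fun x0 => q x0) with q. change (fun x0 => q' x0) with q'.
      rewrite (is_derive_unique _ _ _ (hd y)), (is_derive_unique _ _ _ (hd' y)), ode.
      field.
Qed.

Definition mean (p : R -> R) : R := RInt p 0 (2 * PI) / (2 * PI).
Definition cos_coef (p : R -> R) : R := / PI * RInt (fun x => cos x * p x) 0 (2 * PI).
Definition sin_coef (p : R -> R) : R := / PI * RInt (fun x => sin x * p x) 0 (2 * PI).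

(** For a support function [p] of nonnegative mean this is the support function of the Steiner disc:
    [mean p] is the radius, and the two coefficients are the coordinates of the Steiner point. *)
Definition steiner_part (p : R -> R) (x : R) : R :=
  mean p + cos_coef p * cos x + sin_coef p * sin x.

Definition residue (p : R -> R) (x : R) : R := p x - steiner_part p x.

(** The Steiner part is the orthogonal projection of [p] onto the span of [1], [cos] and [sin]. *)
Lemma residue_orthogonal (p : R -> R) : cont p ->
  RInt (residue p) 0 (2 * PI) = 0 /\
  RInt (fun x => cos x * residue p x) 0 (2 * PI) = 0 /\
  RInt (fun x => sin x * residue p x) 0 (2 * PI) = 0.
Proof.
  intros hc. pose proof PI_RGT_0 as pp.
  (* Products of two of [1], [cos], [sin] are written so that every term but the constant one has
     integral zero; one formula then serves all three claims. *)
  assert (hP : forall a b c d e f : R,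
    RInt (fun x => a + b * cos x + c * sin x + d * (2 * cos x * cos x - 1)
      + e * (sin x * cos x) + f * (2 * sin x * sin x - 1)) 0 (2 * PI) = 2 * PI * a).
  { intros a b c d e f.
    rewrite (RInt_derivative (fun x => a * x + b * sin x - c * cos x
      + d * (sin x * cos x) + e * (sin x ^ 2 / 2) - f * (sin x * cos x))).
    - rewrite sin_2PI, cos_2PI, sin_0, cos_0. eq_R. field.
    - intros x. auto_derive; [exact I|].
      assert (e1 := sin2_cos2 x). unfold Rsqr in e1.
      replace (2 * cos x * cos x - 1) with (cos x * cos x - sin x * sin x) by lra.
      replace (2 * sin x * sin x - 1) with (sin x * sin x - cos x * cos x) by lra.
      field.
    - prove_cont. }
  assert (h0 : RInt p 0 (2 * PI) = 2 * PI * mean p) by (unfold mean; eq_R; field; lra).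
  assert (h1 : RInt (fun x => cos x * p x) 0 (2 * PI) = PI * cos_coef p)
    by (unfold cos_coef; eq_R; field; lra).
  assert (h2 : RInt (fun x => sin x * p x) 0 (2 * PI) = PI * sin_coef p)
    by (unfold sin_coef; eq_R; field; lra).
  revert h0 h1 h2. unfold residue, steiner_part.
  generalize (mean p) (cos_coef p) (sin_coef p). intros a b c h0 h1 h2.
  repeat split.
  - rewrite RInt_sub, h0 by prove_cont.
    rewrite (RInt_eq _ (fun x => a + b * cos x + c * sin x + 0 * (2 * cos x * cos x - 1)
      + 0 * (sin x * cos x) + 0 * (2 * sin x * sin x - 1))), hP by (intros; ring).
    eq_R. ring.
  - rewrite (RInt_eq _ (fun x => cos x * p x -
      (b / 2 + a * cos x + 0 * sin x + b / 2 * (2 * cos x * cos x - 1)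
      + c * (sin x * cos x) + 0 * (2 * sin x * sin x - 1)))) by (intros; field).
    rewrite RInt_sub, hP, h1 by prove_cont. eq_R. field.
  - rewrite (RInt_eq _ (fun x => sin x * p x -
      (c / 2 + 0 * cos x + a * sin x + 0 * (2 * cos x * cos x - 1)
      + b * (sin x * cos x) + c / 2 * (2 * sin x * sin x - 1)))) by (intros; field).
    rewrite RInt_sub, hP, h2 by prove_cont. eq_R. field.
Qed.

(** Here [w] is the radius of curvature minus its mean, and [q'' = w - q]. Each integrand is
    rewritten modulo derivatives of periodic functions, which integrate to zero. *)
Lemma support_integrals (p p' p'' : R -> R) :
  (forall x, is_derive p x (p' x)) -> (forall x, is_derive p' x (p'' x)) ->
  cont p'' -> (forall x, p (x + 2 * PI) = p x) ->
  let q := residue p in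
  let w := fun x => p x + p'' x - mean p in
  RInt (fun x => (p x + p'' x) ^ 2) 0 (2 * PI)
    = 2 * PI * mean p ^ 2 + RInt (fun x => w x ^ 2) 0 (2 * PI) /\
  RInt (fun x => p x ^ 2 - p' x ^ 2) 0 (2 * PI)
    = 2 * PI * mean p ^ 2 + RInt (fun x => q x * w x) 0 (2 * PI) /\
  RInt (fun x => p' x ^ 2 - p'' x ^ 2) 0 (2 * PI)
    = RInt (fun x => q x * w x) 0 (2 * PI) - RInt (fun x => w x ^ 2) 0 (2 * PI) /\
  3 * RInt (fun x => q x ^ 2) 0 (2 * PI)
    <= - RInt (fun x => q x * w x) 0 (2 * PI).
Proof.
  intros hd hd' hc'' hper q w.
  assert (hc' : cont p') by exact (cont_derive _ _ hd').
  assert (hc : cont p) by exact (cont_derive _ _ hd).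
  destruct (residue_orthogonal p hc) as (o0 & o1 & o2). fold q in o0, o1, o2.
  set (a := mean p) in *. set (b := cos_coef p). set (c := sin_coef p).
  set (q' := fun x => p' x - (- b * sin x + c * cos x)).
  assert (hq : forall x, is_derive q x (q' x)).
  { intros x. unfold q, q', residue, steiner_part. fold a b c. auto_derive.
    - exists (p' x). apply hd.
    - change (fun x0 => p x0) with p. rewrite (is_derive_unique _ _ _ (hd x)). ring. }
  assert (hq' : forall x, is_derive q' x (w x - q x)).
  { intros x. unfold w, q, q', residue, steiner_part. fold a b c. auto_derive.
    - exists (p'' x). apply hd'.
    - change (fun x0 => p' x0) with p'. rewrite (is_derive_unique _ _ _ (hd' x)). ring. }
  assert (hcq : cont q) by exact (cont_derive _ _ hq).
  assert (hcq' : cont q') by exact (cont_derive _ _ hq').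
  assert (hcw : cont w) by (unfold w; prove_cont).
  assert (hqper : forall x, q (x + 2 * PI) = q x).
  { intros x. unfold q, residue, steiner_part.
    rewrite hper, cos_plus, sin_plus, cos_2PI, sin_2PI. ring. }
  assert (q0 : q (2 * PI) = q 0) by (rewrite <- (hqper 0); f_equal; ring).
  assert (q'0 : q' (2 * PI) = q' 0).
  { rewrite <- (is_derive_periodic _ _ _ hq hqper 0). f_equal; ring. }
  assert (p0 : p (2 * PI) = p 0) by (rewrite <- (hper 0); f_equal; ring).
  assert (p'0 : p' (2 * PI) = p' 0).
  { rewrite <- (is_derive_periodic _ _ _ hd hper 0). f_equal; ring. }
  assert (dp : forall x, Derive p x = p' x)
    by (intros x; apply (is_derive_unique p), hd).
  assert (dp' : forall x, Derive p' x = p'' x)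
    by (intros x; apply (is_derive_unique p'), hd').
  assert (dq : forall x, Derive q x = q' x)
    by (intros x; apply (is_derive_unique q), hq).
  assert (dq' : forall x, Derive q' x = w x - q x)
    by (intros x; apply (is_derive_unique q'), hq').
  assert (xp : forall x, ex_derive (fun y => p y) x) by (intros x; exists (p' x); apply hd).
  assert (xp' : forall x, ex_derive (fun y => p' y) x) by (intros x; exists (p'' x); apply hd').
  assert (xq : forall x, ex_derive (fun y => q y) x) by (intros x; exists (q' x); apply hq).
  assert (xq' : forall x, ex_derive (fun y => q' y) x)
    by (intros x; exists (w x - q x); apply hq').
  assert (ep : forall x, p x = a + b * cos x + c * sin x + q x)
    by (intros x; unfold q, residue, steiner_part; fold a b c; ring).
  assert (ep'' : forall x, p'' x = w x - b * cos x - c * sin x - q x)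
    by (intros x; unfold w; rewrite (ep x); ring).
  (* The product [p (p + p'')] is [(a + b cos + c sin + q) (a + w)]. Its terms missing from
     [a ^ 2 + 2 a q + q w] are exact derivatives, because [w = q + q''] while [cos] and [sin] are
     killed by [f + f'']. *)
  set (G := fun x => a * q' x + a * (b * sin x - c * cos x)
    + b * (cos x * q' x + sin x * q x) + c * (sin x * q' x - cos x * q x)).
  set (G' := fun x => p x * (p x + p'' x) - (a ^ 2 + 2 * a * q x + q x * w x)).
  assert (hG : forall x, is_derive G x (G' x)).
  { intros x. unfold G, G'. auto_derive; [auto 10|].
    change (fun x0 => q x0) with q. change (fun x0 => q' x0) with q'.
    rewrite dq, dq', ep'', ep. ring. }
  assert (hG'c : cont G') by (unfold G'; prove_cont).
  assert (G0 : RInt G' 0 (2 * PI) = 0).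
  { apply (RInt_periodic_derivative G); [exact hG|exact hG'c|].
    unfold G. now rewrite q'0, q0, sin_2PI, cos_2PI, sin_0, cos_0. }
  set (F := fun x => p x * p' x).
  set (F' := fun x => p' x ^ 2 + p x * p'' x).
  assert (hF : forall x, is_derive F x (F' x)).
  { intros x. unfold F, F'. auto_derive; [auto 10|].
    change (fun x0 => p x0) with p. change (fun x0 => p' x0) with p'.
    rewrite dp, dp'. ring. }
  assert (hF'c : cont F') by (unfold F'; prove_cont).
  assert (F0 : RInt F' 0 (2 * PI) = 0).
  { apply (RInt_periodic_derivative F); [exact hF|exact hF'c|].
    unfold F. now rewrite p'0, p0. }
  assert (hQ'c : cont (fun x => w x - q x)) by prove_cont.
  assert (Q0 : RInt (fun x => w x - q x) 0 (2 * PI) = 0)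
    by now apply (RInt_periodic_derivative q').
  (* The derivative of [q q']: it trades the integral of [q' ^ 2] for that of [q ^ 2 - q w], which
     turns the Wirtinger inequality into the last claim. *)
  set (E' := fun x => q' x ^ 2 + q x * (w x - q x)).
  assert (hE'c : cont E') by (unfold E'; prove_cont).
  assert (E0 : RInt E' 0 (2 * PI) = 0).
  { apply (RInt_periodic_derivative (fun x => q x * q' x)); [|exact hE'c|].
    - intros x. unfold E'. auto_derive; [auto 10|].
      change (fun x0 => q x0) with q. change (fun x0 => q' x0) with q'.
      rewrite dq, dq'. ring.
    - now rewrite q'0, q0. }
  assert (ha : RInt (fun _ => a ^ 2) 0 (2 * PI) = 2 * PI * a ^ 2).
  { rewrite RInt_const. unfold scal; simpl; unfold mult; simpl. eq_R. ring. }
  repeat split.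
  - rewrite (RInt_eq _ (fun x => a ^ 2 + (w x ^ 2
      + 2 * a * (q x + (w x - q x))))) by (intros; unfold w; ring).
    rewrite 2!RInt_add, RInt_mulc, RInt_add, o0, Q0, ha by prove_cont. eq_R. ring.
  - rewrite (RInt_eq _ (fun x => a ^ 2 + (2 * a * q x + (q x * w x
      + (G' x - F' x))))) by (intros; unfold G', F'; ring).
    rewrite 3!RInt_add, RInt_mulc, RInt_sub, o0, G0, F0, ha by prove_cont. eq_R. ring.
  - rewrite (RInt_eq _ (fun x => q x * w x - w x ^ 2 + (G' x + F' x
      - 2 * a * (w x - q x)))) by (intros; unfold G', F', w; ring).
    rewrite RInt_add, 2!RInt_sub, RInt_add, RInt_mulc, Q0, G0, F0 by prove_cont. eq_R. ring.
  - assert (hw := wirtinger_order2 q q' hq hcq' hqper o0 o1 o2).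
    rewrite (RInt_eq _ (fun x => E' x - (q x * w x + 3 * q x ^ 2))) in hw
      by (intros; unfold E'; ring).
    rewrite RInt_sub, RInt_add, RInt_mulc, E0 in hw by prove_cont. lra.
Qed.

(** The right side minus the left side of the main inequality, with [- (X + Y) / 2] as the oriented
    area of the evolute. The three parameter conditions are, up to positive factors, the
    coefficients of [a ^ 2], of the grouped second term and of [Y]; the last term has the fixed
    coefficient [1 / 3]. *)
Lemma deficit (alpha beta lambda delta a X Y Z : R) :
  alpha * (2 * PI * a ^ 2 + X) + beta * (2 * PI * a) ^ 2
    + lambda * (/ 2 * (2 * PI * a ^ 2 - Y)) + delta * (/ 2 * (X + Y)) - Z
  = PI * a ^ 2 * (2 * alpha + 4 * PI * beta + lambda)
    + (2 * alpha + delta) / 2 * ((X - 6 * Y + 9 * Z) + 3 * (Y - 3 * Z))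
    + (18 * alpha - 3 * lambda + 12 * delta - 2) / 6 * Y
    + (Y - 3 * Z) / 3.
Proof. field. Qed.

(** A continuous function whose square has integral zero vanishes, so [w + 3 q = 0]. With
    [q'' = w - q] this is the oscillator equation [q'' = - 4 q]. *)
Lemma residue_second_harmonic (p p' p'' : R -> R) :
  (forall x, is_derive p x (p' x)) -> (forall x, is_derive p' x (p'' x)) ->
  cont p'' -> (forall x, p (x + 2 * PI) = p x) ->
  RInt (fun x => (p x + p'' x - mean p + 3 * residue p x) ^ 2) 0 (2 * PI) = 0 ->
  exists a2 b2, forall x,
    p x = steiner_part p x + a2 * cos (2 * x) + b2 * sin (2 * x).
Proof.
  intros hd hd' hc'' hper h0. pose proof PI_RGT_0 as pp.
  assert (hc : cont p) by exact (cont_derive _ _ hd).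
  set (a := mean p) in *. set (b := cos_coef p). set (c := sin_coef p).
  assert (hcr : cont (residue p)).
  { unfold residue, steiner_part. prove_cont. }
  set (e := fun x => p x + p'' x - a + 3 * residue p x) in *.
  assert (hce : cont e) by (unfold e; prove_cont).
  assert (hrper : forall x, residue p (x + 2 * PI) = residue p x).
  { intros x. unfold residue, steiner_part.
    rewrite hper, cos_plus, sin_plus, cos_2PI, sin_2PI. ring. }
  assert (hp''per := is_derive_periodic _ _ _ hd' (is_derive_periodic _ _ _ hd hper)).
  assert (he : forall x, e x = 0).
  { intros x.
    (* The period is centred at [x], as the vanishing is obtained at interior points only. *)
    apply (RInt_square_eq_0 e (x - PI) (x - PI + 2 * PI)); [lra|exact hce| |lra].
    rewrite (RInt_period (fun y => e y ^ 2)); [exact h0|prove_cont|].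
    intros y. unfold e. now rewrite hper, hp''per, hrper. }
  set (q' := fun x => p' x - (- b * sin x + c * cos x)).
  set (q'' := fun x => p'' x + b * cos x + c * sin x).
  exists (residue p 0), (q' 0 / 2). intros x.
  rewrite Rplus_assoc, <- (harmonic_oscillator (residue p) q' q'').
  - unfold residue. ring.
  - intros y. unfold q', residue, steiner_part. fold a b c. auto_derive.
    + exists (p' y). apply hd.
    + change (fun x0 => p x0) with p. rewrite (is_derive_unique _ _ _ (hd y)). ring.
  - intros y. unfold q', q''. auto_derive.
    + exists (p'' y). apply hd'.
    + change (fun x0 => p' x0) with p'. rewrite (is_derive_unique _ _ _ (hd' y)). ring.
  - intros y. specialize (he y). unfold e in he. unfold q''.
    apply Rminus_diag_uniq. rewrite <- he. unfold residue, steiner_part. fold a b c. ring.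
Qed.

(** * Normal angle and its inverse *)

Lemma norm_plane (z : R * R) : norm z = sqrt (fst z ^ 2 + snd z ^ 2).
Proof.
  destruct z as [a b]. unfold norm; simpl; unfold prod_norm, norm; simpl; unfold abs; simpl.
  f_equal. rewrite !Rmult_1_r, <- !Rabs_mult, !Rabs_pos_eq; trivial; apply Rle_0_sqr.
Qed.

Lemma norm_plane_sq (z : R * R) : norm z ^ 2 = fst z ^ 2 + snd z ^ 2.
Proof.
  rewrite norm_plane, pow2_sqrt; [reflexivity|].
  apply Rplus_le_le_0_compat; apply pow2_ge_0.
Qed.

Lemma norm_plane_pos (z : R * R) : z <> (0, 0) -> 0 < norm z.
Proof.
  intros hz. destruct (norm_ge_0 z) as [h|h]; [exact h|exfalso].
  apply hz. assert (e := norm_plane_sq z). rewrite <- h in e.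
  destruct z as [a b]; simpl in e. f_equal; nra.
Qed.

Lemma unit_vec_surj (a b : R) : a ^ 2 + b ^ 2 = 1 -> exists t, cos t = a /\ sin t = b.
Proof.
  intros h.
  assert (ha : -1 <= a <= 1) by nra.
  assert (hs : sin (acos a) = Rabs b).
  { rewrite sin_acos by exact ha. rewrite <- sqrt_Rsqr_abs. f_equal.
    unfold Rsqr. lra. }
  destruct (Rle_or_lt 0 b) as [hb|hb].
  - exists (acos a). rewrite cos_acos, hs, Rabs_pos_eq; auto.
  - exists (- acos a). rewrite cos_neg, sin_neg, cos_acos, hs, Rabs_left by auto.
    split; ring.
Qed.

(** Equality case of Cauchy-Schwarz: the squared distance of the two unit vectors is [2 - 2 = 0]. *)
Lemma unit_vec_eq (a b t : R) : a ^ 2 + b ^ 2 = 1 -> a * cos t + b * sin t = 1 ->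
  cos t = a /\ sin t = b.
Proof.
  intros h1 h2. assert (e := sin2_cos2 t). unfold Rsqr in e.
  assert (h : Rsqr (cos t - a) + Rsqr (sin t - b) = 0) by (unfold Rsqr; nra).
  destruct (Rplus_sqr_eq_0 _ _ h). split; lra.
Qed.

(** The angle is defined by integrating its expected angular speed [w] from a correct initial value;
    it then has to be shown that it stays the angle of the normal [(v, - u) / s]. *)
Lemma normal_angle (u v u' v' : R -> R) :
  (forall t, is_derive u t (u' t)) -> (forall t, is_derive v t (v' t)) ->
  cont u' -> cont v' -> (forall t, 0 < u t ^ 2 + v t ^ 2) ->
  exists phi : R -> R,
    (forall t, is_derive phi t ((u t * v' t - v t * u' t) / (u t ^ 2 + v t ^ 2))) /\
    (forall t, cos (phi t) = v t / sqrt (u t ^ 2 + v t ^ 2) /\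
               sin (phi t) = - u t / sqrt (u t ^ 2 + v t ^ 2)).
Proof.
  intros hu hv hcu hcv hpos.
  assert (cu : cont u) by exact (cont_derive _ _ hu).
  assert (cv : cont v) by exact (cont_derive _ _ hv).
  set (s := fun t => sqrt (u t ^ 2 + v t ^ 2)).
  assert (s2 : forall t, s t * s t = u t ^ 2 + v t ^ 2).
  { intros t. apply sqrt_sqrt. specialize (hpos t). lra. }
  assert (spos : forall t, 0 < s t) by (intros t; apply sqrt_lt_R0, hpos).
  assert (unit_n : forall t, (v t / s t) ^ 2 + (- u t / s t) ^ 2 = 1).
  { intros t. specialize (s2 t). specialize (spos t).
    transitivity ((u t ^ 2 + v t ^ 2) / (s t * s t)); [field; lra|].
    rewrite s2. field. specialize (hpos t). lra. }
  set (w := fun t => (u t * v' t - v t * u' t) / (u t ^ 2 + v t ^ 2)).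
  assert (cw : cont w).
  { intros t. unfold w, Rdiv. apply continuous_Rmult; [prove_cont|].
    apply continuous_Rinv_comp; [prove_cont|]. specialize (hpos t). lra. }
  destruct (unit_vec_surj _ _ (unit_n 0)) as [phi0 [c0 s0]].
  set (phi := fun t => phi0 + RInt w 0 t).
  assert (hphi : forall t, is_derive phi t (w t)).
  { intros t. unfold phi.
    assert (d : is_derive (fun t => RInt w 0 t) t (w t)).
    { apply (is_derive_RInt w (RInt w 0) 0 t); [|apply cw].
      apply filter_forall. intros b.
      exact (@RInt_correct R_CompleteNormedModule w 0 b (ex_RInt_cont w 0 b cw)). }
    revert d. change (fun t => RInt w 0 t) with (RInt w 0).
    generalize (RInt w 0). intros W d. auto_derive; [now exists (w t)|].
    change (fun x => W x) with W. rewrite (is_derive_unique _ _ _ d). ring. }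
  exists phi. split; [exact hphi|].
  assert (ds : forall t, is_derive s t ((u t * u' t + v t * v' t) / s t)).
  { intros t. unfold s. specialize (hpos t). auto_derive.
    - repeat split; [exists (u' t); apply hu|exists (v' t); apply hv|].
      simpl in hpos. lra.
    - change (fun x => u x) with u. change (fun x => v x) with v.
      rewrite (is_derive_unique _ _ _ (hu t)), (is_derive_unique _ _ _ (hv t)).
      simpl. field. apply Rgt_not_eq. specialize (spos t). exact spos. }
  (* The inner product of the normal with the direction [phi]: both rotate at speed [w], so it keeps
     its initial value [1]. *)
  set (C := fun t => (v t * cos (phi t) - u t * sin (phi t)) / s t).
  assert (dC : forall t, is_derive C t 0).
  { intros t. unfold C. specialize (spos t). specialize (s2 t). auto_derive.
    - repeat split; [exists (v' t)|exists (w t)|exists (u' t)|exists (w t)| |]; auto.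
      + eexists; apply ds.
      + lra.
    - change (fun x => u x) with u. change (fun x => v x) with v.
      change (fun x => phi x) with phi. change (fun x => s x) with s.
      rewrite (is_derive_unique _ _ _ (hu t)), (is_derive_unique _ _ _ (hv t)),
        (is_derive_unique _ _ _ (hphi t)), (is_derive_unique _ _ _ (ds t)).
      unfold w. rewrite <- s2. field_simplify_eq; [|lra]. 
      replace (s t ^ 2) with (u t ^ 2 + v t ^ 2) by lra. ring. }
  assert (hC : forall t, C t = 1).
  { intros t. rewrite (zero_derivative C dC). unfold C, phi.
    rewrite RInt_point. unfold zero; simpl. rewrite Rplus_0_r, c0, s0.
    rewrite <- (unit_n 0). field. specialize (spos 0). lra. }
  intros t. apply unit_vec_eq; [apply unit_n|].
  rewrite <- (hC t). unfold C, s. field.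
  specialize (spos t). unfold s in spos. lra.
Qed.

Lemma increasing_of_derive (f f' : R -> R) :
  (forall x, is_derive f x (f' x)) -> (forall x, 0 < f' x) ->
  forall a b, a < b -> f a < f b.
Proof.
  intros hd hp a b hab.
  destruct (MVT_cor2 f f' a b hab) as (c & e & _).
  - intros c _. apply is_derive_Reals, hd.
  - specialize (hp c). nra.
Qed.

(** Each period adds the same [c > 0] to [f], so [f] is unbounded in both directions and the
    intermediate value theorem applies. *)
Lemma surjective_of_periodic_derive (f f' : R -> R) (T : R) :
  0 < T -> (forall x, is_derive f x (f' x)) -> (forall x, 0 < f' x) ->
  (forall x, f' (x + T) = f' x) -> forall y, exists x, f x = y.
Proof.
  intros hT hd hp hper y.
  assert (inc := increasing_of_derive f f' hd hp).
  set (c := f (0 + T) - f 0).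
  assert (hc : 0 < c) by (apply Rlt_0_minus, inc; lra).
  assert (hstep : forall x, f (x + T) = f x + c).
  { assert (h := zero_derivative (fun x => f (x + T) - f x)).
    intros x. enough (f (x + T) - f x = c) by lra. apply h. intros z. auto_derive.
    - repeat split; [exists (f' (z + T))|exists (f' z)]; apply hd.
    - change (fun x0 => f x0) with f.
      rewrite (is_derive_unique _ _ _ (hd (z + T))), (is_derive_unique _ _ _ (hd z)), hper.
      ring. }
  assert (hn : forall n : nat, f (INR n * T) = f 0 + INR n * c /\
                               f (- (INR n * T)) = f 0 - INR n * c).
  { induction n as [|n [IH1 IH2]].
    - simpl. split; [|replace (- (0 * T)) with (0 * T) by ring];
        rewrite Rmult_0_l; ring.
    - rewrite S_INR. split.
      + replace ((INR n + 1) * T) with (INR n * T + T) by ring.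
        rewrite hstep, IH1. ring.
      + assert (e := hstep (- ((INR n + 1) * T))).
        replace (- ((INR n + 1) * T) + T) with (- (INR n * T)) in e by ring. lra. }
  destruct (INR_archimed c (Rabs (y - f 0)) hc) as [n hlt].
  destruct (hn n) as [e1 e2].
  assert (hy := Rle_abs (y - f 0)). assert (hy' := Rle_abs (- (y - f 0))).
  rewrite Rabs_Ropp in hy'.
  destruct (IVT_cor (fun x => f x - y) (- (INR n * T)) (INR n * T)) as [x [_ hx]].
  - intros x. apply continuity_pt_filterlim. change (continuous (fun x => f x - y) x).
    assert (cont f) by exact (cont_derive _ _ hd). prove_cont.
  - assert (0 <= INR n * T); [apply Rmult_le_pos; [apply pos_INR|lra]|lra].
  - rewrite e1, e2. nra.
  - exists x. lra.
Qed.

(** Since [f] increases strictly, inequalities transfer between [f x] and [y] on one side and [x]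
    and [g y] on the other. This gives continuity of [g], as the inverse function rule demands. *)
Lemma inverse_derive (f f' g : R -> R) :
  (forall x, is_derive f x (f' x)) -> (forall x, 0 < f' x) ->
  (forall y, f (g y) = y) -> forall y, is_derive g y (/ f' (g y)).
Proof.
  intros hd hp hg y.
  assert (inc := increasing_of_derive f f' hd hp).
  assert (hlt : forall y x, f x < y -> x < g y).
  { intros z x h. destruct (Rlt_or_le x (g z)) as [|[h'|h']]; [assumption| |].
    - apply inc in h'. rewrite hg in h'. lra.
    - subst x. rewrite hg in h. lra. }
  assert (hgt : forall y x, y < f x -> g y < x).
  { intros z x h. destruct (Rlt_or_le (g z) x) as [|[h'|h']]; [assumption| |].
    - apply inc in h'. rewrite hg in h'. lra.
    - subst x. rewrite hg in h. lra. }
  assert (hc : continuity_pt g y).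
  { apply continuity_pt_filterlim, filterlim_locally. intros e.
    assert (pe := cond_pos e).
    assert (h1 : f (g y - e) < y) by (rewrite <- (hg y) at 2; apply inc; lra).
    assert (h2 : y < f (g y + e)) by (rewrite <- (hg y) at 1; apply inc; lra).
    assert (hdl : 0 < Rmin (y - f (g y - e)) (f (g y + e) - y))
      by (apply Rmin_pos; lra).
    exists (mkposreal _ hdl). intros z hz.
    unfold ball in *; simpl in *; unfold AbsRing_ball, abs, minus, plus, opp in *;
      simpl in *.
    apply Rabs_def2 in hz.
    assert (m1 := Rmin_l (y - f (g y - e)) (f (g y + e) - y)).
    assert (m2 := Rmin_r (y - f (g y - e)) (f (g y + e) - y)).
    assert (g y - e < g z) by (apply hlt; lra).
    assert (g z < g y + e) by (apply hgt; lra).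
    apply Rabs_def1; lra. }
  assert (hder : forall x, derivable_pt f x).
  { intros x. exists (f' x). apply is_derive_Reals, hd. }
  assert (hval : derive_pt f (g y) (hder (g y)) = f' (g y)).
  { apply derive_pt_eq_0, is_derive_Reals, hd. }
  assert (mono : g (y - 1) <= g y <= g (y + 1)).
  { split; left; apply hlt || apply hgt; rewrite hg; lra. }
  apply is_derive_Reals.
  replace (/ f' (g y)) with (1 / derive_pt f (g y) (hder (g y)))
    by (rewrite hval; unfold Rdiv; apply Rmult_1_l).
  apply (Ranalysis5.derivable_pt_lim_recip_interv f g (y - 1) (y + 1) y
           (fun x _ => hder x) hc ltac:(lra) ltac:(lra) mono).
  - intros z _. apply hg.
  - rewrite hval. apply Rgt_not_eq, hp.
Qed.

Lemma sign_near_simple_zero (h : R -> R) (t l : R) :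
  is_derive h t l -> 0 < l -> h t = 0 ->
  exists d, 0 < d /\ forall e, 0 < e < d -> 0 < h (t + e) /\ h (t - e) < 0.
Proof.
  intros hd hl h0. apply is_derive_Reals in hd.
  (* With tolerance [l], the difference quotient stays within [l] of [l], hence positive. *)
  destruct (hd l hl) as [d hdl]. exists d. split; [apply cond_pos|].
  intros e he.
  assert (hpos : forall k, k <> 0 -> Rabs k < d -> 0 < h (t + k) / k).
  { intros k hk hkd. specialize (hdl k hk hkd). rewrite h0, Rminus_0_r in hdl.
    apply Rabs_def2 in hdl. lra. }
  split.
  - assert (q := hpos e ltac:(lra) ltac:(rewrite Rabs_pos_eq; lra)).
    replace (h (t + e)) with (h (t + e) / e * e) by (field; lra). nra.
  - assert (q := hpos (- e) ltac:(lra) ltac:(rewrite Rabs_Ropp, Rabs_pos_eq; lra)).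
    change (t - e) with (t + - e).
    replace (h (t + - e)) with (h (t + - e) / - e * - e) by (field; lra). nra.
Qed.

(** * Support functions of C^2_+ domains *)

(** The weights are left unnormalized. The point [m] of the open segment from [z1] to [z2] is
    interior, and [z] lies strictly between [m] and [z3], or equals [m] if these coincide. *)
Lemma strictly_convex_triangle (K : R * R -> Prop) (z1 z2 z3 z : R * R) (a1 a2 a3 : R) :
  strictly_convex K -> K z1 -> K z2 -> K z3 -> z1 <> z2 ->
  0 < a1 -> 0 < a2 -> 0 < a3 ->
  (a1 + a2 + a3) * fst z = a1 * fst z1 + a2 * fst z2 + a3 * fst z3 ->
  (a1 + a2 + a3) * snd z = a1 * snd z1 + a2 * snd z2 + a3 * snd z3 ->
  locally z K.
Proof.
  intros hK k1 k2 k3 hne p1 p2 p3 ex ey.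
  set (s := a1 / (a1 + a2)).
  assert (hs : 0 < s < 1).
  { unfold s. split; [apply Rdiv_lt_0_compat; lra|].
    apply (Rmult_lt_reg_r (a1 + a2)); [lra|].
    unfold Rdiv. rewrite Rmult_assoc, Rinv_l; lra. }
  set (m := plus (scal s z1) (scal (1 - s) z2)).
  assert (hm : locally m K) by (apply hK; assumption).
  set (r := (a1 + a2) / (a1 + a2 + a3)).
  assert (hr : 0 < r < 1).
  { unfold r. split; [apply Rdiv_lt_0_compat; lra|].
    apply (Rmult_lt_reg_r (a1 + a2 + a3)); [lra|].
    unfold Rdiv. rewrite Rmult_assoc, Rinv_l; lra. }
  assert (hz : z = plus (scal r m) (scal (1 - r) z3)).
  { destruct z as [x y], z1 as [x1 y1], z2 as [x2 y2], z3 as [x3 y3].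
    unfold m, plus, scal; simpl in *; unfold prod_plus, prod_scal, plus, scal; simpl.
    unfold mult; simpl. f_equal.
    - apply (Rmult_eq_reg_l (a1 + a2 + a3)); [|lra]. rewrite ex.
      unfold r, s. field. lra.
    - apply (Rmult_eq_reg_l (a1 + a2 + a3)); [|lra]. rewrite ey.
      unfold r, s. field. lra. }
  destruct (Classical_Prop.classic (m = z3)) as [e|ne].
  - rewrite hz, <- e. replace (plus (scal r m) (scal (1 - r) m)) with m; [exact hm|].
    assert (hc : forall c : R, c = r * c + (1 - r) * c) by (intros; ring).
    destruct m as [mx my].
    unfold plus, scal; simpl; unfold prod_plus, prod_scal, plus, scal; simpl.
    unfold mult; simpl. f_equal; apply hc.
  - rewrite hz. apply hK; auto. exact (locally_singleton m K hm).
Qed.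

Lemma curve_in_domain K gamma T (hK : C2plus_domain K gamma T) (t : R) : K (gamma t).
Proof.
  apply (C2plus_closed _ _ _ hK).
  assert (hb : boundary K (gamma t)) by (apply (C2plus_boundary _ _ _ hK); now exists t).
  exact (proj2 hb).
Qed.

Lemma curve_not_interior K gamma T (hK : C2plus_domain K gamma T) (t : R) :
  ~ locally (gamma t) K.
Proof.
  assert (hb : boundary K (gamma t)) by (apply (C2plus_boundary _ _ _ hK); now exists t).
  exact (proj1 hb).
Qed.

Lemma velocity_sq_pos K gamma T (hK : C2plus_domain K gamma T) (t : R) :
  0 < Derive (xcoord gamma) t ^ 2 + Derive (ycoord gamma) t ^ 2.
Proof.
  assert (h := norm_plane_pos _ (C2plus_regular _ _ _ hK t)).
  assert (e := norm_plane_sq (velocity gamma t)). simpl fst in e; simpl snd in e.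
  rewrite <- e. now apply pow_lt.
Qed.

Lemma turning_pos K gamma T (hK : C2plus_domain K gamma T) (t : R) :
  0 < Derive (xcoord gamma) t * Derive (Derive (ycoord gamma)) t
      - Derive (ycoord gamma) t * Derive (Derive (xcoord gamma)) t.
Proof.
  assert (h := norm_plane_pos _ (C2plus_regular _ _ _ hK t)).
  assert (c := C2plus_curvature_pos _ _ _ hK t).
  unfold curvature in c. apply (pow_lt _ 3) in h.
  match goal with |- 0 < ?a =>
    replace a with (a / norm (velocity gamma t) ^ 3 * norm (velocity gamma t) ^ 3)
      by (field; apply Rgt_not_eq; apply norm_plane_pos, (C2plus_regular _ _ _ hK t)) end.
  apply Rmult_lt_0_compat; assumption.
Qed.

(* Otherwise [gamma t] is interior to the triangle with vertices [z] and
   [gamma (t + e)], [gamma (t - e)] for small [e], as the curve bends away from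
   the outward side of its tangent. *)
Lemma supporting_tangent K gamma T (hK : C2plus_domain K gamma T) (t : R) (z : R * R) :
  K z ->
  (fst z - xcoord gamma t) * Derive (ycoord gamma) t
  - (snd z - ycoord gamma t) * Derive (xcoord gamma) t <= 0.
Proof.
  intros hz.
  assert (hin := curve_in_domain K gamma T hK).
  assert (hni := curve_not_interior K gamma T hK t).
  assert (hv := velocity_sq_pos K gamma T hK t).
  assert (hc := turning_pos K gamma T hK t).
  assert (hconv := C2plus_strictly_convex _ _ _ hK).
  destruct (C2plus_x_C2 _ _ _ hK) as (dx & ddx & _).
  destruct (C2plus_y_C2 _ _ _ hK) as (dy & ddy & _).
  assert (hxy : forall s, gamma s = (xcoord gamma s, ycoord gamma s))
    by (intros s; apply surjective_pairing).
  revert dx ddx dy ddy hv hc hxy.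
  generalize (xcoord gamma) (ycoord gamma). intros x y dx ddx dy ddy hv hc hxy.
  destruct z as [zx zy]; simpl.
  set (u := Derive x t) in *. set (v := Derive y t) in *.
  (* Coordinates centred at [gamma t], up to the speed: [f] along the outward normal [(v, - u)], [g]
     along the tangent [(u, v)]. The point [z] has coordinates [wf] and [wg]. *)
  set (f := fun s => (x s - x t) * v - (y s - y t) * u).
  set (f' := fun s => Derive x s * v - Derive y s * u).
  set (g := fun s => (x s - x t) * u + (y s - y t) * v).
  set (wf := (zx - x t) * v - (zy - y t) * u).
  set (wg := (zx - x t) * u + (zy - y t) * v).
  destruct (Rle_or_lt wf 0) as [h|hwf]; [exact h|exfalso].
  assert (hf : forall s, is_derive f s (f' s)).
  { intros s. unfold f, f'. auto_derive; [auto|].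
    change (fun x0 => x x0) with x. change (fun x0 => y x0) with y. ring. }
  (* Positive turning makes [f'] change from positive to negative at [t], so that [f < 0] on both
     sides of [t]. *)
  destruct (sign_near_simple_zero (fun s => - f' s) t
    (u * Derive (Derive y) t - v * Derive (Derive x) t)) as (d1 & d1p & s1).
  { unfold f'. auto_derive; [repeat split; auto|].
    change (fun x0 => Derive x x0) with (Derive x).
    change (fun x0 => Derive y x0) with (Derive y). ring. }
  { exact hc. }
  { unfold f'. fold u v. ring. }
  destruct (sign_near_simple_zero g t (u ^ 2 + v ^ 2)) as (d2 & d2p & s2).
  { unfold g. auto_derive; [auto|].
    change (fun x0 => x x0) with x. change (fun x0 => y x0) with y. fold u v. ring. }
  { exact hv. }
  { unfold g. ring. }
  destruct (sign_near_simple_zero (fun s => wf * g s - wg * f s) t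
    (wf * (u ^ 2 + v ^ 2))) as (d3 & d3p & s3).
  { unfold g, f. auto_derive; [repeat split; auto|].
    change (fun x0 => x x0) with x. change (fun x0 => y x0) with y. fold u v. ring. }
  { apply Rmult_lt_0_compat; assumption. }
  { unfold g, f. ring. }
  set (e := Rmin d1 (Rmin d2 d3) / 2).
  assert (he : 0 < e /\ e < d1 /\ e < d2 /\ e < d3).
  { unfold e, Rmin. repeat destruct Rle_dec; lra. }
  destruct he as (e0 & e1 & e2 & e3).
  destruct (s2 e (conj e0 e2)) as [gp gm].
  destruct (s3 e (conj e0 e3)) as [hp hm].
  assert (ft : f t = 0) by (unfold f; ring).
  assert (fp : f (t + e) < 0).
  { destruct (MVT_cor2 f f' t (t + e)) as (c & ec & c1 & c2); [lra| |].
    - intros c _. apply is_derive_Reals, hf.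
    - destruct (s1 (c - t)) as [q _]; [lra|].
      replace (t + (c - t)) with c in q by ring. rewrite ft in ec. nra. }
  assert (fm : f (t - e) < 0).
  { destruct (MVT_cor2 f f' (t - e) t) as (c & ec & c1 & c2); [lra| |].
    - intros c _. apply is_derive_Reals, hf.
    - destruct (s1 (t - c)) as [_ q]; [lra|].
      replace (t - (t - c)) with c in q by ring. rewrite ft in ec. nra. }
  apply hni.
  (* The barycentric weights of the origin in a triangle are the cross products of pairs of
     vertices; the sign analysis above makes all three positive. *)
  apply (strictly_convex_triangle K (gamma (t + e)) (gamma (t - e)) (zx, zy) (gamma t)
    (f (t - e) * wg - g (t - e) * wf) (wf * g (t + e) - wg * f (t + e))
    (f (t + e) * g (t - e) - g (t + e) * f (t - e))); auto.
  - intros eq. rewrite 2!hxy in eq. injection eq as ex ey.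
    unfold g in gp, gm. rewrite ex, ey in gp. lra.
  - lra.
  - nra.
  - rewrite !hxy. simpl. unfold wf, wg, f, g. ring.
  - rewrite !hxy. simpl. unfold wf, wg, f, g. ring.
Qed.

Lemma support_attained (K : R * R -> Prop) (theta : R) (z0 : R * R) :
  K z0 -> (forall z, K z -> dot z (unit_vec theta) <= dot z0 (unit_vec theta)) ->
  support K theta = dot z0 (unit_vec theta).
Proof.
  intros h0 hmax. unfold support.
  rewrite (is_lub_Rbar_unique _ (Finite (dot z0 (unit_vec theta)))); [reflexivity|].
  split.
  - intros s (z & hz & ->). apply hmax, hz.
  - intros b hb. apply hb. now exists z0.
Qed.

(** Cauchy-Schwarz, by way of Lagrange's identity. *)
Lemma dot_unit_le_norm (z : R * R) (theta : R) : dot z (unit_vec theta) <= norm z.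
Proof.
  assert (e := sin2_cos2 theta). unfold Rsqr in e.
  assert (h := norm_plane_sq z). assert (p := norm_ge_0 z).
  destruct z as [a b]. unfold dot, unit_vec; simpl in *.
  apply Rnot_lt_le. intros hlt.
  assert (0 <= (a * sin theta - b * cos theta) ^ 2) by apply pow2_ge_0.
  assert ((a * cos theta + b * sin theta) ^ 2 + (a * sin theta - b * cos theta) ^ 2
    = (a ^ 2 + b ^ 2) * (sin theta * sin theta + cos theta * cos theta)) by ring.
  rewrite e in *. nra.
Qed.

Lemma dot_minus (z a : R * R) (theta : R) :
  dot z (unit_vec theta) = dot a (unit_vec theta) + dot (minus z a) (unit_vec theta).
Proof.
  destruct z as [x y], a as [a b].
  unfold dot, minus, plus, opp; simpl; unfold prod_plus, prod_opp, plus, opp; simpl. ring.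
Qed.

Lemma disc_extreme (a : R * R) (r theta : R) : 0 <= r ->
  exists z, norm (minus z a) = r /\
            dot z (unit_vec theta) = dot a (unit_vec theta) + r.
Proof.
  intros hr. exists (fst a + r * cos theta, snd a + r * sin theta).
  assert (e := sin2_cos2 theta). unfold Rsqr in e. split.
  - rewrite norm_plane. destruct a as [a b].
    unfold minus, plus, opp; simpl; unfold prod_plus, prod_opp, plus, opp; simpl.
    transitivity (sqrt (r ^ 2)); [f_equal|exact (sqrt_pow2 r hr)].
    transitivity (r ^ 2 * (sin theta * sin theta + cos theta * cos theta)); [ring|].
    rewrite e. ring.
  - unfold dot, unit_vec; simpl.
    transitivity (fst a * cos theta + snd a * sin theta
      + r * (sin theta * sin theta + cos theta * cos theta)); [ring|].
    rewrite e. ring.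
Qed.

Lemma support_closed_disc (a : R * R) (r theta : R) : 0 <= r ->
  support (closed_disc a r) theta = dot a (unit_vec theta) + r.
Proof.
  intros hr. destruct (disc_extreme a r theta hr) as (z0 & h0 & e0).
  rewrite <- e0. apply support_attained.
  - unfold closed_disc. rewrite h0. apply Rle_refl.
  - intros z hz. rewrite e0, (dot_minus z a). apply Rplus_le_compat_l.
    eapply Rle_trans; [apply dot_unit_le_norm|exact hz].
Qed.

Lemma support_periodic (K : R * R -> Prop) (theta : R) :
  support K (theta + 2 * PI) = support K theta.
Proof.
  unfold support, unit_vec. rewrite cos_plus, sin_plus, cos_2PI, sin_2PI.
  replace (cos theta * 1 - sin theta * 0) with (cos theta) by ring.
  replace (sin theta * 1 + cos theta * 0) with (sin theta) by ring. reflexivity.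
Qed.

Lemma speed_eq (c : R -> R * R) (t : R) :
  norm (velocity c t) = sqrt (Derive (xcoord c) t ^ 2 + Derive (ycoord c) t ^ 2).
Proof. apply norm_plane. Qed.

(** Here [tau] inverts the normal angle. In differentiating [p = <gamma (tau), u>] the velocity
    drops out, being orthogonal to the normal [u], so [p' = <gamma (tau), u'>]; one more derivative
    brings in the velocity and with it the radius of curvature. *)
Lemma support_of_domain K gamma T (hK : C2plus_domain K gamma T) :
  exists tau p' p'' : R -> R,
    (forall theta, outward_normal gamma (tau theta) = unit_vec theta) /\
    (forall theta, support K theta = dot (gamma (tau theta)) (unit_vec theta)) /\
    (forall theta t, dot (gamma t) (unit_vec theta) <= support K theta) /\
    (forall theta, is_derive (support K) theta (p' theta)) /\
    (forall theta, is_derive p' theta (p'' theta)) /\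
    cont p'' /\
    (forall theta, support K theta + p'' theta = / curvature gamma (tau theta)).
Proof.
  assert (hv := velocity_sq_pos K gamma T hK).
  assert (hturn := turning_pos K gamma T hK).
  assert (hsup := supporting_tangent K gamma T hK).
  destruct (C2plus_x_C2 _ _ _ hK) as (dx & ddx & cx).
  destruct (C2plus_y_C2 _ _ _ hK) as (dy & ddy & cy).
  assert (hT := C2plus_period_pos _ _ _ hK).
  assert (hper : forall t, xcoord gamma (t + T) = xcoord gamma t /\
                           ycoord gamma (t + T) = ycoord gamma t).
  { intros t. unfold xcoord, ycoord. now rewrite (C2plus_periodic _ _ _ hK). }
  assert (hin := curve_in_domain K gamma T hK).
  assert (hdot : forall t theta, dot (gamma t) (unit_vec theta)
    = xcoord gamma t * cos theta + ycoord gamma t * sin theta) by reflexivity.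
  assert (hcurv : forall t, curvature gamma t
    = (Derive (xcoord gamma) t * Derive (Derive (ycoord gamma)) t
       - Derive (ycoord gamma) t * Derive (Derive (xcoord gamma)) t)
      / sqrt (Derive (xcoord gamma) t ^ 2 + Derive (ycoord gamma) t ^ 2) ^ 3).
  { intros t. unfold curvature. now rewrite speed_eq. }
  assert (hnormal : forall t, outward_normal gamma t
    = (Derive (ycoord gamma) t
         / sqrt (Derive (xcoord gamma) t ^ 2 + Derive (ycoord gamma) t ^ 2),
       - Derive (xcoord gamma) t
         / sqrt (Derive (xcoord gamma) t ^ 2 + Derive (ycoord gamma) t ^ 2))).
  { intros t. unfold outward_normal. rewrite speed_eq. simpl.
    unfold scal; simpl; unfold prod_scal, scal; simpl; unfold mult; simpl.
    f_equal; apply Rmult_comm. }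
  set (x := xcoord gamma) in *. set (y := ycoord gamma) in *.
  set (u := Derive x) in *. set (v := Derive y) in *.
  set (u' := Derive u) in *. set (v' := Derive v) in *.
  assert (hx : forall t, is_derive x t (u t)) by (intros t; apply Derive_correct, dx).
  assert (hy : forall t, is_derive y t (v t)) by (intros t; apply Derive_correct, dy).
  assert (hu : forall t, is_derive u t (u' t)) by (intros t; apply Derive_correct, ddx).
  assert (hv' : forall t, is_derive v t (v' t)) by (intros t; apply Derive_correct, ddy).
  assert (pu := is_derive_periodic _ _ _ hx (fun t => proj1 (hper t))).
  assert (pv := is_derive_periodic _ _ _ hy (fun t => proj2 (hper t))).
  assert (pu' := is_derive_periodic _ _ _ hu pu).
  assert (pv' := is_derive_periodic _ _ _ hv' pv).
  destruct (normal_angle u v u' v' hu hv' cx cy hv) as (phi & dphi & nphi).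
  set (w := fun t => (u t * v' t - v t * u' t) / (u t ^ 2 + v t ^ 2)) in *.
  assert (wpos : forall t, 0 < w t).
  { intros t. apply Rdiv_lt_0_compat; [apply hturn|apply hv]. }
  assert (wper : forall t, w (t + T) = w t).
  { intros t. unfold w. now rewrite pu, pv, pu', pv'. }
  assert (surj := surjective_of_periodic_derive phi w T hT dphi wpos wper).
  set (tau := fun theta =>
    proj1_sig (ClassicalEpsilon.constructive_indefinite_description _ (surj theta))).
  assert (htau : forall theta, phi (tau theta) = theta).
  { intros theta. unfold tau. apply proj2_sig. }
  assert (dtau := inverse_derive phi w tau dphi wpos htau).
  set (s := fun t => sqrt (u t ^ 2 + v t ^ 2)) in *.
  assert (s2 : forall t, s t * s t = u t ^ 2 + v t ^ 2).
  { intros t. apply sqrt_sqrt. specialize (hv t). lra. }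
  assert (spos : forall t, 0 < s t) by (intros t; apply sqrt_lt_R0, hv).
  assert (hcos : forall theta, cos theta * s (tau theta) = v (tau theta)).
  { intros theta. destruct (nphi (tau theta)) as [e _]. rewrite htau in e.
    rewrite e. unfold s. field. apply Rgt_not_eq, spos. }
  assert (hsin : forall theta, sin theta * s (tau theta) = - u (tau theta)).
  { intros theta. destruct (nphi (tau theta)) as [_ e]. rewrite htau in e.
    rewrite e. unfold s. field. apply Rgt_not_eq, spos. }
  (* The vector [(v, - u)] of the supporting tangent is [s] times [unit_vec theta] at
     [tau theta]. *)
  assert (hmax : forall theta z, K z ->
    dot z (unit_vec theta) <= dot (gamma (tau theta)) (unit_vec theta)).
  { intros theta z hz. specialize (hsup (tau theta) z hz).
    rewrite <- hcos in hsup.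
    replace (u (tau theta)) with (- (sin theta * s (tau theta))) in hsup
      by (rewrite hsin; ring).
    rewrite hdot. unfold dot, unit_vec; simpl.
    specialize (spos (tau theta)). apply Rminus_le_0.
    apply (Rmult_le_reg_r (s (tau theta))); [exact spos|]. lra. }
  assert (hsupp : forall theta,
    support K theta = dot (gamma (tau theta)) (unit_vec theta)).
  { intros theta. apply support_attained; [apply hin|apply hmax]. }
  set (p' := fun theta => - x (tau theta) * sin theta + y (tau theta) * cos theta).
  (* Speed divided by angular speed, [s / w]: the reciprocal of the curvature. *)
  set (rad := fun t => s t ^ 3 * / (u t * v' t - v t * u' t)).
  exists tau, p', (fun theta => - support K theta + rad (tau theta)).
  assert (xt : forall theta, ex_derive tau theta)
    by (intros theta; eexists; apply dtau).
  assert (dp : forall theta, is_derive (support K) theta (p' theta)).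
  { intros theta.
    apply (is_derive_ext (fun theta => x (tau theta) * cos theta + y (tau theta) * sin theta)).
    { intros q. now rewrite hsupp, hdot. }
    unfold p'. auto_derive; [repeat split; auto|].
    change (fun t => x t) with x. change (fun t => y t) with y.
    change (fun t => tau t) with tau. fold u v.
    rewrite <- (hcos theta).
    replace (u (tau theta)) with (- (sin theta * s (tau theta))) by (rewrite hsin; ring).
    ring. }
  assert (dp' : forall theta, is_derive p' theta (- support K theta + rad (tau theta))).
  { intros theta. rewrite hsupp, hdot. unfold p'. auto_derive; [repeat split; auto|].
    change (fun t => x t) with x. change (fun t => y t) with y.
    change (fun t => tau t) with tau. fold u v.
    rewrite (is_derive_unique _ _ _ (dtau theta)).
    assert (e := sin2_cos2 theta). unfold Rsqr in e.
    assert (hs : - u (tau theta) * sin theta + v (tau theta) * cos theta = s (tau theta)).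
    { rewrite <- hsin, <- hcos.
      transitivity (s (tau theta) * (sin theta * sin theta + cos theta * cos theta));
        [ring|]. rewrite e. ring. }
    transitivity (- (x (tau theta) * cos theta + y (tau theta) * sin theta)
      + / w (tau theta) * (- u (tau theta) * sin theta + v (tau theta) * cos theta));
      [ring|].
    rewrite hs. f_equal. unfold rad, w. rewrite <- s2.
    specialize (spos (tau theta)). specialize (hturn (tau theta)).
    field. split; lra. }
  assert (crad : cont rad).
  { intros t. unfold rad. apply continuous_Rmult; [apply continuous_Rpow|].
    - apply (continuous_comp (fun t => u t ^ 2 + v t ^ 2) sqrt); [|apply continuous_sqrt].
      assert (cont u) by exact (cont_derive _ _ hu).
      assert (cont v) by exact (cont_derive _ _ hv'). prove_cont.
    - apply continuous_Rinv_comp; [|apply Rgt_not_eq, hturn].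
      assert (cont u) by exact (cont_derive _ _ hu).
      assert (cont v) by exact (cont_derive _ _ hv').
      assert (cont u') by exact cx. assert (cont v') by exact cy. prove_cont. }
  refine (conj _ (conj hsupp (conj _ (conj dp (conj dp' (conj _ _)))))).
  - intros theta. rewrite hnormal. fold (s (tau theta)). unfold unit_vec.
    specialize (spos (tau theta)). rewrite <- hcos, <- hsin.
    f_equal; field; lra.
  - intros theta t. rewrite hsupp. apply hmax, hin.
  - intros theta. apply continuous_Rplus.
    + apply continuous_Ropp. apply (cont_derive _ _ dp).
    + apply (continuous_comp tau rad); [apply (cont_derive _ _ dtau)|apply crad].
  - intros theta. rewrite hcurv. fold (s (tau theta)). unfold rad.
    specialize (spos (tau theta)). specialize (hturn (tau theta)).
    field. split; lra.
Qed.

Lemma curvature_radius_pos K gamma T (hK : C2plus_domain K gamma T) t :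
  0 < / curvature gamma t.
Proof. apply Rinv_0_lt_compat, (C2plus_curvature_pos _ _ _ hK). Qed.

(** * The inequality and its equality cases *)

Theorem theorem4p3
  (K : R * R -> Prop) (gamma : R -> R * R) (T : R) (rho : R -> R)
  (hK : C2plus_domain K gamma T)
  (hrho : is_radius_of_curvature gamma rho)
  (alpha beta lambda delta : R)
  (h1 : 2 * alpha + delta >= 0)
  (h2' : 2 * alpha + 4 * PI * beta + lambda >= 0)
  (h3 : 18 * alpha - 3 * lambda + 12 * delta - 2 >= 0) :
  let lhs := h2 K (steiner_disc K) ^ 2 in
  let rhs := alpha * RInt (fun theta => rho theta ^ 2) 0 (2 * PI)
             + beta * perimeter K ^ 2
             + lambda * area K
             + delta * Rabs (evolute_area K) in
  lhs <= rhs /\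
  (is_circle gamma -> 2 * alpha + 4 * PI * beta + lambda = 0 -> lhs = rhs) /\
  (lhs = rhs ->
   2 * alpha + delta > 0 ->
   2 * alpha + 4 * PI * beta + lambda = 0 ->
   18 * alpha - 3 * lambda + 12 * delta - 2 = 0 ->
   exists a0 a1 b1 a2 b2 : R, forall theta : R,
     support K theta = a0 + a1 * cos theta + b1 * sin theta
                       + a2 * cos (2 * theta) + b2 * sin (2 * theta)).
Proof.
  intros lhs rhs. assert (pp := PI_RGT_0).
  destruct (support_of_domain K gamma T hK)
    as (tau & p' & p'' & hn & hsupp & hmax & hd & hd' & hc'' & hrad).
  assert (hper := support_periodic K).
  assert (hc' : cont p') by exact (cont_derive _ _ hd').
  assert (hc : cont (support K)) by exact (cont_derive _ _ hd).
  set (p := support K) in *. set (a := mean p) in *.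
  set (q := residue p) in *. set (w := fun x => p x + p'' x - a) in *.
  assert (hcq : cont q) by (unfold q, residue, steiner_part; prove_cont).
  assert (hcw : cont w) by (unfold w; prove_cont).
  (* [rho] is prescribed only at angles that occur as normals; [tau] shows that every angle does. *)
  assert (hrho' : forall theta, rho theta = p theta + p'' theta).
  { intros theta. rewrite hrad. apply hrho, hn. }
  assert (hP : perimeter K = 2 * PI * a).
  { unfold perimeter, a, mean. fold p. eq_R. field. lra. }
  assert (hL : RInt (fun x => p x + p'' x) 0 (2 * PI) = 2 * PI * a).
  { rewrite <- hP, RInt_add by assumption.
    rewrite (RInt_periodic_derivative p' p''); [apply Rplus_0_r|assumption..|].
    rewrite <- (is_derive_periodic _ _ _ hd hper 0). f_equal; ring. }
  (* [a] is the radius of the Steiner disc, and the support function of a disc is computed for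
     nonnegative radius. *)
  assert (ha : 0 <= a).
  { assert (0 <= 2 * PI * a); [|nra].
    rewrite <- hL. apply RInt_nonneg; [lra|prove_cont|].
    intros x. rewrite hrad. left. apply (curvature_radius_pos K gamma T hK). }
  set (X := RInt (fun x => w x ^ 2) 0 (2 * PI)).
  set (V := RInt (fun x => q x * w x) 0 (2 * PI)). set (Y := - V).
  set (Z := RInt (fun x => q x ^ 2) 0 (2 * PI)).
  assert (ints : RInt (fun x => (p x + p'' x) ^ 2) 0 (2 * PI) = 2 * PI * a ^ 2 + X /\
    RInt (fun x => p x ^ 2 - p' x ^ 2) 0 (2 * PI) = 2 * PI * a ^ 2 + V /\
    RInt (fun x => p' x ^ 2 - p'' x ^ 2) 0 (2 * PI) = V - X /\ 3 * Z <= Y)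
    by exact (support_integrals p p' p'' hd hd' hc'' hper).
  destruct ints as (i1 & i2 & i3 & i4).
  assert (hX : 0 <= X) by (apply RInt_nonneg; [lra|prove_cont|intros; apply pow2_ge_0]).
  assert (hZ : 0 <= Z) by (apply RInt_nonneg; [lra|prove_cont|intros; apply pow2_ge_0]).
  assert (hXYZ : RInt (fun x => (w x + 3 * q x) ^ 2) 0 (2 * PI) = X - 6 * Y + 9 * Z).
  { rewrite (RInt_eq _ (fun x => w x ^ 2 + (6 * (q x * w x) + 9 * q x ^ 2)))
      by (intros; ring).
    rewrite 2!RInt_add, 2!RInt_mulc by prove_cont. unfold X, Y, V, Z. eq_R. ring. }
  assert (hXYZ0 : 0 <= X - 6 * Y + 9 * Z).
  { rewrite <- hXYZ. apply RInt_nonneg; [lra|prove_cont|intros; apply pow2_ge_0]. }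
  assert (elhs : lhs = Z).
  { unfold lhs, h2.
    assert (e : RInt (fun theta => Rabs (support K theta
      - support (steiner_disc K) theta) ^ 2) 0 (2 * PI) = Z).
    { apply RInt_eq. intros x. unfold steiner_disc.
      rewrite support_closed_disc; rewrite hP.
      2:{ replace (2 * PI * a / (2 * PI)) with a by (field; lra). exact ha. }
      rewrite pow2_abs. f_equal. fold p. unfold q, residue, steiner_part, dot; simpl.
      fold a. unfold cos_coef, sin_coef. fold p. eq_R. field. lra. }
    rewrite e. now apply pow2_sqrt. }
  assert (earea : area K = / 2 * (2 * PI * a ^ 2 - Y)).
  { unfold area. f_equal.
    rewrite (RInt_eq _ (fun x => p x ^ 2 - p' x ^ 2)), i2.
    - unfold Y. lra.
    - intros x. fold p. now rewrite (is_derive_unique _ _ _ (hd x)). }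
  (* The oriented area of the evolute is nonpositive, because [0 <= 3 * Z <= Y]. *)
  assert (eevol : Rabs (evolute_area K) = / 2 * (X + Y)).
  { assert (e : evolute_area K = - (/ 2 * (X + Y))).
    { unfold evolute_area.
      rewrite (RInt_eq _ (fun x => p' x ^ 2 - p'' x ^ 2)), i3.
      - unfold Y. lra.
      - intros x. fold p. rewrite (is_derive_unique _ _ _ (hd x)).
        rewrite (Derive_ext _ p') by (intros t; apply is_derive_unique, hd).
        now rewrite (is_derive_unique _ _ _ (hd' x)). }
    rewrite e, Rabs_Ropp. apply Rabs_pos_eq. lra. }
  assert (erho : RInt (fun theta => rho theta ^ 2) 0 (2 * PI) = 2 * PI * a ^ 2 + X).
  { rewrite <- i1. apply RInt_eq. intros x. now rewrite hrho'. }
  assert (edef := deficit alpha beta lambda delta a X Y Z).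
  rewrite <- erho, <- hP, <- earea, <- eevol in edef. fold rhs in edef.
  repeat split.
  - assert (n1 : 0 <= PI * a ^ 2 * (2 * alpha + 4 * PI * beta + lambda)).
    { apply Rmult_le_pos; [|lra]. apply Rmult_le_pos; [lra|apply pow2_ge_0]. }
    assert (n2 : 0 <= (2 * alpha + delta) / 2
      * (X - 6 * Y + 9 * Z + 3 * (Y - 3 * Z))) by (apply Rmult_le_pos; lra).
    assert (n3 : 0 <= (18 * alpha - 3 * lambda + 12 * delta - 2) / 6 * Y)
      by (apply Rmult_le_pos; lra).
    lra.
  - intros (ctr & r & hr & hcirc) hzero.
    (* One bound holds as the support point lies at distance [r] from the centre, the other as the
       extreme point of the circle lies on the curve. *)
    assert (hp : forall theta, p theta = r + (fst ctr * cos theta + snd ctr * sin theta)).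
    { intros theta. apply Rle_antisym.
      - rewrite hsupp, (dot_minus _ ctr).
        assert (hN : norm (minus (gamma (tau theta)) ctr) = r)
          by (apply hcirc; now exists (tau theta)).
        assert (hle := dot_unit_le_norm (minus (gamma (tau theta)) ctr) theta).
        rewrite hN in hle. unfold dot at 1, unit_vec at 1; simpl. lra.
      - destruct (disc_extreme ctr r theta (Rlt_le _ _ hr)) as (z & hz & ez).
        apply hcirc in hz. destruct hz as [t <-].
        assert (hle := hmax theta t). rewrite ez in hle.
        unfold dot, unit_vec in hle; simpl in hle. fold p in hle. lra. }
    assert (hp' : forall theta, p' theta = - fst ctr * sin theta + snd ctr * cos theta).
    { intros theta. rewrite <- (is_derive_unique _ _ _ (hd theta)), (Derive_ext _ _ _ hp).
      apply is_derive_unique. auto_derive; [exact I|ring]. }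
    assert (hp'' : forall theta, p'' theta = - fst ctr * cos theta - snd ctr * sin theta).
    { intros theta. rewrite <- (is_derive_unique _ _ _ (hd' theta)), (Derive_ext _ _ _ hp').
      apply is_derive_unique. auto_derive; [exact I|ring]. }
    assert (hsum : forall theta, p theta + p'' theta = r)
      by (intros theta; rewrite hp, hp''; ring).
    assert (har : a = r).
    { rewrite (RInt_eq _ (fun _ => r) _ _ hsum), RInt_const in hL.
      unfold scal in hL; simpl in hL; unfold mult in hL; simpl in hL. nra. }
    assert (hw : forall x, w x = 0) by (intros x; unfold w; rewrite hsum, har; ring).
    assert (hI0 : RInt (fun _ => 0) 0 (2 * PI) = 0).
    { rewrite RInt_const. unfold scal; simpl; unfold mult; simpl. apply Rmult_0_r. }
    assert (X0 : X = 0).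
    { transitivity (RInt (fun _ => 0) 0 (2 * PI)); [|exact hI0].
      apply RInt_eq. intros x. rewrite hw. ring. }
    assert (Y0 : Y = 0).
    { unfold Y. rewrite <- Ropp_0. f_equal.
      transitivity (RInt (fun _ => 0) 0 (2 * PI)); [|exact hI0].
      apply RInt_eq. intros x. rewrite hw. ring. }
    assert (Z0 : Z = 0) by lra.
    rewrite X0, Y0, Z0, hzero in edef. lra.
  - intros heq hA hzero hB. rewrite hzero, hB, <- heq, elhs in edef.
    (* Two coefficients vanish and the deficit is zero, so the remaining nonnegative terms all
       vanish; [2 * alpha + delta > 0] isolates this one. *)
    assert (h0 : X - 6 * Y + 9 * Z = 0) by nra.
    destruct (residue_second_harmonic p p' p'' hd hd' hc'' hper) as (a2 & b2 & h).
    { now rewrite <- hXYZ in h0. }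
    exists a, (cos_coef p), (sin_coef p), a2, b2. exact h.
Qed.
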